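(* For any positive integer $m$ and strict partition $\lambda=(\lambda_1>\cdots>\lambda_k)$ with $k$ parts, \[ |\mathit{SPP}(m;\lambda)|^2=|\mathit{PP}_{sym}(m;\overline{\lambda})|^2=2^{k}\operatorname{M}(\widetilde{A}(m;\lambda;\emptyset)). \]
   Context: A shifted plane partition of shifted shape $\lambda$ is an array of nonnegative integers $\pi=(\pi_{i,j})_{1\le i\le k,\ i\le j\le \lambda_i+i-1}$ with $\pi_{i,j}\ge\pi_{i+1,j}$ and $\pi_{i,j}\ge\pi_{i,j+1}$ whenever both entries are defined; $\mathit{SPP}(m;\lambda)$ is the set of those with all entries at most $m$. $\overline{\lambda}$ is the symmetric partition (Young diagram invariant under transposition) whose $i$-th row has $\lambda_i+i-1$ boxes for $1\le i\le k$ and whose Durfee square has size $k$. For a symmetric partition $\mu$, a plane partition of shape $\mu$ is an array $(\pi_{i,j})$ of nonnegative integers indexed by the boxes of the Young diagram of $\mu$, weakly decreasing along rows and columns; it is symmetric if $\pi_{i,j}=\pi_{j,i}$; $\mathit{PP}_{sym}(m;\mu)$ is the set of symmetric plane partitions of shape $\mu$ with all entries at most $m$. Triangular lattice: points $P(a,b)=a e_1+b e_2$ with $e_1=(\sqrt3/2,1/2)$, $e_2=(0,1)$; $R(a,b)$ is the unit triangle with vertices $P(a,b),P(a,b+1),P(a+1,b)$ and $L(a,b)$ the one with vertices $P(a+1,b),P(a+1,b+1),P(a,b+1)$. A lozenge is the union of two unit triangles sharing an edge; tilings, their weights (product of lozenge weights) and $\operatorname{M}(R)$ (sum of weights of all tilings)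 are as usual. $\widetilde{A}(m;\lambda;\emptyset)$ is the union of: for each $c\in\{k,\ldots,m+k-1\}$, the triangles $R(a,c),L(a,c)$ with $-\lambda_1\le a\le-1$ and $R(a,c-a),L(a,c-a-1)$ with $0\le a\le\lambda_1$; for each $i\in[k]$, with $c=k-i$, the triangles $R(a,c)$ with $-\lambda_i+1\le a\le-1$, $L(a,c)$ with $-\lambda_i\le a\le -1$, $R(a,c-a),L(a,c-a-1)$ with $0\le a\le \lambda_i-1$, and $R(\lambda_i,c-\lambda_i)$. For each $i\in[k]$ the lozenge $L(\lambda_i-1,k-i-\lambda_i)\cup R(\lambda_i,k-i-\lambda_i)$ has weight $1/2$, all other lozenges weight $1$; all boundaries are solid. *)

(* Defs.v *)
From HB Require Import structures.
From mathcomp Require Import all_boot all_order all_algebra.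
From mathcomp Require Import finmap zify.

Set Implicit Arguments.
Unset Strict Implicit.
Unset Printing Implicit Defensive.

Import Order.TTheory GRing.Theory Num.Theory.

(* Rows, columns and parts are indexed from 1: [part s i] is the i-th part of
   [s] (for i >= 1), and 0 beyond the last part. *)
Definition part (s : seq nat) (i : nat) : nat := nth 0 s i.-1.

Definition is_partition (mu : seq nat) : bool :=
  sorted geq mu && (0 \notin mu).

Definition is_strict_partition (lam : seq nat) : bool :=
  sorted gtn lam && (0 \notin lam).

Definition cell : Type := (nat * nat)%type.

(* [iota 1 n] enumerates 1..n, and [iota i n] enumerates i..(n + i - 1). *)
Definition young_diagram (mu : seq nat) : {fset cell} :=
  [fset x in [seq (i, j) | i <- iota 1 (size mu), j <- iota 1 (part mu i)]]%fset.

Definition shifted_diagram (lam : seq nat) : {fset cell} :=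
  [fset x in [seq (i, j) | i <- iota 1 (size lam), j <- iota i (part lam i)]]%fset.

Definition is_symmetric (mu : seq nat) : Prop :=
  forall i j, ((i, j) \in young_diagram mu) = ((j, i) \in young_diagram mu).

Definition durfee (mu : seq nat) : nat :=
  \max_(d < (size mu).+1 | all (fun i => d <= part mu i) (iota 1 d)) d.

Definition is_overline (lam mu : seq nat) : Prop :=
  [/\ is_partition mu,
      is_symmetric mu,
      forall i, 1 <= i <= size lam -> part mu i = part lam i + i - 1
    & durfee mu = size lam].

(* The partition described by [is_overline]. By symmetry it has lam_1 rows, and
   its i-th row, for i > k, is as long as its i-th column, which lies in the
   first k rows. Lemmas [overlineP] and [overline_uniq] below show that this is
   the only partition satisfying [is_overline]. *)
Definition overline (lam : seq nat) : seq nat :=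
  [seq (if i <= size lam then part lam i + i - 1
        else count (fun j => i <= part lam j + j - 1) (iota 1 (size lam)))
  | i <- iota 1 (part lam 1)].

(* An array of integers in [0, m] indexed by D is an element of
   {ffun D -> 'I_m.+1}. *)
Definition weakly_decreasing (m : nat) (D : {fset cell})
    (pi : {ffun D -> 'I_m.+1}) : bool :=
  [forall x : D, forall y : D,
    ((val y == ((val x).1.+1, (val x).2)) || (val y == ((val x).1, (val x).2.+1)))
      ==> (pi y <= pi x)].

Definition symmetric_array (m : nat) (D : {fset cell})
    (pi : {ffun D -> 'I_m.+1}) : bool :=
  [forall x : D, forall y : D,
    (val y == ((val x).2, (val x).1)) ==> (pi x == pi y)].

Definition SPP (m : nat) (lam : seq nat) :
    {set {ffun shifted_diagram lam -> 'I_m.+1}} :=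
  [set pi | weakly_decreasing pi].

Definition PPsym (m : nat) (mu : seq nat) :
    {set {ffun young_diagram mu -> 'I_m.+1}} :=
  [set pi | weakly_decreasing pi & symmetric_array pi].

(* [Rtri a b] and [Ltri a b] are the unit triangles R(a,b) and L(a,b). *)
Inductive triangle : Type := Rtri of int & int | Ltri of int & int.

Definition triangle_code (t : triangle) : bool * (int * int) :=
  match t with Rtri a b => (true, (a, b)) | Ltri a b => (false, (a, b)) end.

Definition triangle_decode (u : bool * (int * int)) : triangle :=
  if u.1 then Rtri u.2.1 u.2.2 else Ltri u.2.1 u.2.2.

Lemma triangle_codeK : cancel triangle_code triangle_decode.
Proof. by case. Qed.

HB.instance Definition _ := Countable.copy triangle (can_type triangle_codeK).

(* The pair (a, b) stands for the lattice point P(a,b) = a e_1 + b e_2. *)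
Definition vertices (t : triangle) : seq (int * int) :=
  match t with
  | Rtri a b => [:: (a, b); (a, b + 1); (a + 1, b)]%R
  | Ltri a b => [:: (a + 1, b); (a + 1, b + 1); (a, b + 1)]%R
  end.

(* Two unit triangles share an edge when they have exactly two common
   vertices; in particular they are distinct. *)
Definition share_edge (t u : triangle) : bool :=
  count [in vertices u] (vertices t) == 2.

Definition is_lozenge (A : {fset triangle}) (l : {set A}) : bool :=
  [exists t : A, exists u : A, (l == [set t; u]) && share_edge (val t) (val u)].

Definition is_tiling (A : {fset triangle}) (T : {set {set A}}) : bool :=
  partition T [set: A] && [forall l in T, is_lozenge l].

(* The tiling generating function M(A), for a weight [w] on lozenges, given
   as sets of triangles. Lozenges may not stick out of A. *)
Definition tiling_gf (A : {fset triangle}) (w : {fset triangle} -> rat) : rat :=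
  (\sum_(T : {set {set A}} | is_tiling T)
     \prod_(l in T) w [fset val t | t in l]%fset)%R.

Definition int_range (a b : int) : seq int :=
  [seq (a + i%:Z)%R | i <- iota 0 `|Num.max 0%R (b - a + 1)%R|%N].

Lemma mem_int_range (a b x : int) :
  (x \in int_range a b) = ((a <= x)%R && (x <= b)%R).
Proof.
apply/mapP/andP => [[i]|[ax xb]]; first by rewrite mem_iota => hi ->; lia.
by exists `|x - a|%N; [rewrite mem_iota|]; lia.
Qed.

Local Open Scope ring_scope.

Definition upper_row (lam : seq nat) (c : int) : seq triangle :=
  let l1 : int := (part lam 1)%:Z in
  [seq Rtri a c | a <- int_range (- l1) (-1)] ++
  [seq Ltri a c | a <- int_range (- l1) (-1)] ++
  [seq Rtri a (c - a) | a <- int_range 0 l1] ++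
  [seq Ltri a (c - a - 1) | a <- int_range 0 l1].

Definition lower_row (lam : seq nat) (i : nat) : seq triangle :=
  let c : int := (size lam)%:Z - i%:Z in
  let li : int := (part lam i)%:Z in
  [seq Rtri a c | a <- int_range (- li + 1) (-1)] ++
  [seq Ltri a c | a <- int_range (- li) (-1)] ++
  [seq Rtri a (c - a) | a <- int_range 0 (li - 1)] ++
  [seq Ltri a (c - a - 1) | a <- int_range 0 (li - 1)] ++
  [:: Rtri li (c - li)].

Definition region_A (m : nat) (lam : seq nat) : {fset triangle} :=
  let k : int := (size lam)%:Z in
  [fset t in flatten [seq upper_row lam c | c <- int_range k (m%:Z + k - 1)] ++
             flatten [seq lower_row lam i | i <- iota 1 (size lam)]]%fset.

Definition half_lozenge (lam : seq nat) (i : nat) : {fset triangle} :=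
  let li : int := (part lam i)%:Z in
  let b : int := (size lam)%:Z - i%:Z - li in
  [fset Ltri (li - 1) b; Rtri li b]%fset.

Definition weight_A (lam : seq nat) (l : {fset triangle}) : rat :=
  if l \in [seq half_lozenge lam i | i <- iota 1 (size lam)] then 1 / 2 else 1.

Definition M_A (m : nat) (lam : seq nat) : rat :=
  tiling_gf (region_A m lam) (weight_A lam).

Local Close Scope ring_scope.

Lemma mem_young mu i j :
  ((i, j) \in young_diagram mu) = [&& 0 < i, 0 < j & j <= part mu i].
Proof.
rewrite inE /=; apply/allpairsPdep/and3P => [[i' [j' []]]|[i0 j0 h]].
  by rewrite !mem_iota => hi hj [-> ->]; split; lia.
exists i, j; rewrite !mem_iota; split => //; last by lia.
have hs : i.-1 < size mu.
  by rewrite ltnNge; apply/negP => hs; move: h; rewrite /part nth_default //; lia.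
by lia.
Qed.

Lemma mem_shifted lam i j :
  ((i, j) \in shifted_diagram lam) =
  [&& 0 < i, i <= size lam, i <= j & j < part lam i + i].
Proof.
rewrite inE /=; apply/allpairsPdep/and4P => [[i' [j' []]]|[i0 j0 h h']].
  by rewrite !mem_iota => hi hj [-> ->]; split; lia.
by exists i, j; rewrite !mem_iota; split => //; lia.
Qed.

Lemma part_noninc mu i j :
  is_partition mu -> 0 < i -> i <= j -> part mu j <= part mu i.
Proof.
move=> /andP[s _] i0 ij; rewrite /part.
have [hj|hj] := leqP (size mu) j.-1; first by rewrite nth_default.
have := @sorted_leq_nth _ geq _ _ 0 mu s i.-1 j.-1.
rewrite !inE /= => h; apply: h; try lia.
- by move=> a b c /= h1 h2; exact: leq_trans h2 h1.
- by move=> a /=.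
Qed.

Lemma part_gt0 (mu : seq nat) i :
  0 \notin mu -> (0 < i <= size mu) ==> (0 < part mu i).
Proof.
move=> h; apply/implyP => hi; rewrite lt0n; apply: contra h => /eqP <-.
by rewrite /part; apply: mem_nth; move: hi; case: i => // i /andP[].
Qed.

Lemma part_strict lam i j : is_strict_partition lam ->
  [&& 0 < i, i <= j & j <= size lam] ==> (part lam j + j <= part lam i + i).
Proof.
move=> /andP[s _]; apply/implyP => /and3P[i0 ij hj]; elim: j ij hj => [|j IH] ij hj; first by lia.
have [->//|nij] := eqVneq i j.+1.
apply: leq_trans (IH _ _); try lia.
have := @sorted_ltn_nth _ gtn _ 0 lam s j.-1 j.
rewrite !inE /= => h.
have {}h : part lam j.+1 < part lam j.
  rewrite /part /=; apply: h; try lia.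
  by move=> a b c /= h1 h2; exact: ltn_trans h2 h1.
by lia.
Qed.

Lemma count_initial (p : pred nat) k j :
  (forall a b, 0 < a -> a <= b -> b <= k -> p b -> p a) ->
  0 < j -> (j <= count p (iota 1 k)) = (j <= k) && p j.
Proof.
elim: k => [|k IH] hp j0; first by case: j j0.
rewrite -{1}[k.+1]addn1 iotaD count_cat /= add1n addn0.
have hp' a b : 0 < a -> a <= b -> b <= k -> p b -> p a.
  by move=> h1 h2 h3; apply: hp => //; lia.
have [hk|hk] := boolP (p k.+1); last first.
  rewrite addn0 IH //; have [->|nj] := eqVneq j k.+1.
    by rewrite (negbTE hk) andbF; lia.
  by congr andb; lia.
have -> : count p (iota 1 k) = k.
  rewrite -[RHS](size_iota 1 k); apply/eqP; rewrite -all_count.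
  by apply/allP => i; rewrite mem_iota => hi; apply: hp hk; lia.
rewrite addn1; have [hj|//] := boolP (j <= k.+1).
by rewrite (hp j k.+1).
Qed.

Lemma part_overline lam i : is_strict_partition lam -> 0 < i ->
  part (overline lam) i =
  if i <= size lam then part lam i + i - 1
  else count (fun j => i <= part lam j + j - 1) (iota 1 (size lam)).
Proof.
move=> hl i0; have hs x y := @part_strict lam x y hl; case/andP: (hl) => _ h0.
rewrite {1}/part.
have [hi|hi] := leqP (part lam 1) i.-1.
  rewrite nth_default; last by rewrite size_map size_iota.
  have [ik|ki] := leqP i (size lam).
    have := hs 1 i; have := @part_gt0 lam i h0; lia.
  symmetry; apply/eqP; rewrite -leqn0 leqNgt -has_count; apply/hasPn => j.
  rewrite mem_iota => hj; have := hs 1 j; lia.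
rewrite (nth_map 0) ?size_iota // nth_iota //.
by rewrite add1n prednK.
Qed.

Lemma mem_overline lam i j : is_strict_partition lam ->
  ((i, j) \in young_diagram (overline lam)) =
  [&& 0 < i, 0 < j &
    if i <= size lam then j <= part lam i + i - 1
    else (j <= size lam) && (i <= part lam j + j - 1)].
Proof.
move=> hl; have hs x y := @part_strict lam x y hl; rewrite mem_young.
case: (ltnP 0 i) => //= i0; case: (ltnP 0 j) => //= j0.
rewrite part_overline //; case: ifP => // _.
rewrite count_initial // => a b a0 ab bk h.
by have := hs a b; lia.
Qed.

Lemma overline_sym lam : is_strict_partition lam -> is_symmetric (overline lam).
Proof.
move=> hl i j; have hs x y := @part_strict lam x y hl; rewrite !mem_overline //.
case/andP: (hl) => _ h0; case: (ltnP 0 i) => /= i0; last by rewrite andbF.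
case: (ltnP 0 j) => //= j0.
case: (leqP i (size lam)) => hi; case: (leqP j (size lam)) => hj //=.
have := @part_gt0 lam (size lam) h0.
have := hs i (size lam); have := hs j (size lam); lia.
Qed.

Lemma overline_partition lam :
  is_strict_partition lam -> is_partition (overline lam).
Proof.
move=> hl; have hsym := overline_sym hl; have hs x y := @part_strict lam x y hl.
case/andP: (hl) => _ h0.
have szE : size (overline lam) = part lam 1 by rewrite size_map size_iota.
apply/andP; split.
  apply/(sortedP 0) => i hi /=.
  rewrite -[nth 0 _ i.+1]/(part (overline lam) i.+2).
  rewrite -[nth 0 _ i]/(part (overline lam) i.+1).
  apply: contraT => h; have : (i.+2, part (overline lam) i.+2) \in
    young_diagram (overline lam) by rewrite mem_young; lia.
  have : (i.+1, part (overline lam) i.+2) \notin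
    young_diagram (overline lam) by rewrite mem_young; lia.
  rewrite !mem_overline //=.
  set x := part (overline lam) i.+2; have := hs i.+1 i.+2.
  have := hs x (size lam); have := @part_gt0 lam (size lam) h0.
  have := @part_gt0 lam x h0; have := hs i.+1 (size lam).
  case: (leqP i.+2 (size lam)) => hi2; case: (leqP i.+1 (size lam)) => hi1;
    by lia.
apply/negP => /(nthP 0)[i hi] hz.
suff : (i.+1, 1) \in young_diagram (overline lam).
  by rewrite mem_young /part /= hz.
have lam0 : 0 < size lam by case: (lam) hi.
rewrite hsym mem_overline //=; rewrite lam0; move: hi; rewrite szE; lia.
Qed.

Lemma durfeeP mu k : is_partition mu ->
  (durfee mu = k) <->
  ((forall i, 0 < i <= k -> k <= part mu i) /\ part mu k.+1 <= k).
Proof.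
move=> hm.
have szP d : all (fun i => d <= part mu i) (iota 1 d) -> d <= size mu.
  move=> /allP h; case: d h => // d h.
  have := h d.+1; rewrite mem_iota => /(_ ltac:(lia)).
  by rewrite ltnNge [d < _]ltnNge; apply: contra => hd;
    rewrite /part nth_default.
have dmax d : all (fun i => d <= part mu i) (iota 1 d) -> d <= durfee mu.
  move=> h; have hd : d < (size mu).+1 by rewrite ltnS szP.
  exact: (@leq_bigmax_cond _ (fun d : 'I_(size mu).+1 =>
    all (fun i => d <= part mu i) (iota 1 d)) (fun d => nat_of_ord d)
    (Ordinal hd) h).
have dall : all (fun i => durfee mu <= part mu i) (iota 1 (durfee mu)).
  rewrite /durfee; elim/big_ind: _ => // x y hx hy.
  by rewrite /maxn; case: ifP.
split => [<-|[h1 h2]].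
  split => [i hi|]; first by apply: (allP dall); rewrite mem_iota; lia.
  rewrite leqNgt; apply/negP => h.
  have : (durfee mu).+1 <= durfee mu; last by rewrite ltnn.
  apply: dmax; apply/allP => i; rewrite mem_iota => hi.
  by apply: leq_trans h _; apply: part_noninc => //; lia.
apply/eqP; rewrite eqn_leq; apply/andP; split; last first.
  by apply: dmax; apply/allP => i; rewrite mem_iota => hi; apply: h1; lia.
rewrite leqNgt; apply/negP => h.
have := allP dall k.+1; rewrite mem_iota => /(_ ltac:(lia)).
by move=> h3; lia.
Qed.

Lemma overlineP lam : is_strict_partition lam -> is_overline lam (overline lam).
Proof.
move=> hl; have hp := overline_partition hl; have hs x y := @part_strict lam x y hl.
case/andP: (hl) => _ h0.
split=> //; first exact: overline_sym.
  by move=> i /andP[i0 ik]; rewrite part_overline // ik.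
apply/durfeeP => //; split=> [i /andP[i0 ik]|].
  rewrite part_overline // ik.
  by have := hs i (size lam); have := @part_gt0 lam (size lam) h0; lia.
rewrite part_overline // ltnn.
by rewrite (leq_trans (count_size _ _)) // size_iota.
Qed.

Lemma young_inj mu nu : is_partition mu -> is_partition nu ->
  (forall i j, ((i, j) \in young_diagram mu) = ((i, j) \in young_diagram nu)) ->
  mu = nu.
Proof.
move=> /andP[_ hm] /andP[_ hn] h.
have hE i : 0 < i -> part mu i = part nu i.
  move=> i0; have := h i (part mu i); have := h i (part nu i).
  rewrite !mem_young; lia.
have hS : size mu = size nu.
  have := @part_gt0 mu (size mu) hm; have := @part_gt0 nu (size nu) hn.
  have := hE (size mu); have := hE (size nu).
  case: (ltngtP (size mu) (size nu)) => // hlt.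
    by rewrite [part mu (size nu)]nth_default; lia.
  by move=> _; rewrite [part nu (size mu)]nth_default; lia.
by apply: (eq_from_nth hS) => i _; exact: (hE i.+1).
Qed.

Lemma overline_uniq lam mu :
  is_strict_partition lam -> is_overline lam mu -> mu = overline lam.
Proof.
move=> hl [hp hsym hrow /(durfeeP _ hp)[_ hd]].
apply: young_inj => // [|i j]; first exact: overline_partition.
have small a b : size lam < a -> size lam < b ->
    (a, b) \notin young_diagram mu.
  move=> ha hb; rewrite mem_young.
  by have := @part_noninc mu (size lam).+1 a hp isT ha; lia.
rewrite mem_overline //.
case: (leqP i (size lam)) => hi.
  by rewrite mem_young; case: (ltnP 0 i) => //= i0; rewrite hrow // i0.
case: (leqP j (size lam)) => hj /=.
  rewrite hsym mem_young; case: (ltnP 0 j) => /= j0; last by rewrite andbF.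
  by rewrite hrow ?j0.
by rewrite (negbTE (small _ _ hi hj)) !andbF.
Qed.

(* Main.v *)
Require Import Defs.
From mathcomp Require Import all_boot all_order all_algebra.
From mathcomp Require Import finmap.
From mathcomp Require Import zify ring.

(** Cut the region along its central column. The left half, with the set [S] of
    rows in which a lozenge sticks out into the centre prescribed, has [p_S]
    tilings, where [p_S] is a maximal minor of a matrix of path counts with
    columns [v_0, v_1, ...]; [p_S] is also the number of shifted plane partitions
    with main diagonal encoded by [S]. For the right half one gets, up to a power
    of 2, the minor [q_T] of the matrix with columns [v_n + v_(n-1)], the half
    weights being responsible for the second summand. Tilings of the central
    column exist, and are unique, exactly when [S] and [T] interlace, so the claim
    is that [(sum_S p_S)^2] is the sum of [p_S q_T] over interlacing pairs. With
    [F_n X] the sum of the minors formed by some of the first [n] columns followed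
    by the columns [X], one shows by induction on [n] that the part of that sum
    with [S] and [T] among the first [n] rows, completed by columns [Y] and [X], is
    the exchange sum [sum_J +- F_n (J X) F_n (Y \ J)]; the induction needs the
    vanishing of such sums when [Y] is longer than [X] by at least 2, which are
    Pluecker relations. At [X = Y = []] the exchange sum is [F_n^2]. *)

(** The obstacle is that interlacing is a condition on the pair (S, T), so the sum of the p_S q_T is
    not visibly a product. The exchange sum is a bilinear substitute that can follow a scan of the
    rows. After an odd number of elements the scan is in a second state, and there the exchange sum
    alone is wrong: it needs a correction in v_(n-1), which is exactly what the second summand of
    v_n + v_(n-1) cancels.

    The minors are obtained without a theorem on nonintersecting paths. Triangles are removed one
    lozenge at a time, from the top of a column downwards. A column is again in one of two states:
    either nothing is pending, or the next inner triangle was already used by the outer triangle of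
    the row above it. On the algebraic side the second state is an extra column in the minor,
    holding a running sum of letters. Since minors are additive and alternating in their columns,
    each removal is matched by splitting such a column or by the appearance of two equal ones. *)

Set Implicit Arguments.
Unset Strict Implicit.
Unset Printing Implicit Defensive.

Import Order.TTheory GRing.Theory Num.Theory.

(** * Words of columns, minors and exchange sums *)

Local Open Scope ring_scope.

(* A letter is a column vector with infinitely many rows. *)
Definition letter : Type := nat -> rat.

Definition wordfun : Type := seq letter -> rat.

Definition pushf (x : letter) (f : wordfun) : wordfun := fun W => f (x :: W).

(** The interior product with the [r]-th coordinate. The sign is + at the first letter, so the
    minors built from it list their rows from the last to the first; with this convention they turn
    out to be counts, without a sign. *)
Fixpoint contract (r : nat) (f : wordfun) (X : seq letter) : rat :=
  if X is x :: X' then x r * f X' - contract r (pushf x f) X' else 0.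

(* The determinant of the first [n] rows of the matrix with the given columns,
   expanded along its last row; it is 0 unless there are exactly [n] columns. *)
Fixpoint wdet (n : nat) : wordfun :=
  if n is n'.+1 then contract n' (wdet n') else fun X => (nilp X)%:R.

(* Sum over the subwords [J] of [Y] of [+- f J * g (Y \ J)]. *)
Fixpoint exch (e : rat) (f g : wordfun) (Y : seq letter) : rat :=
  if Y is y :: Y' then
    exch e f (pushf y g) Y' + e * (-1) ^+ size Y' * exch e (pushf y f) g Y'
  else f [::] * g [::].

Lemma contract_ext r f g X :
  (forall W, (size W).+1 = size X -> f W = g W) ->
  contract r f X = contract r g X.
Proof.
elim: X f g => //= x X IH f g h; rewrite h // (IH _ (pushf x g)) // => W hW.
by apply: h; rewrite /= hW.
Qed.

Lemma contractD r a b f g X :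
  contract r (fun W => a * f W + b * g W) X = a * contract r f X + b * contract r g X.
Proof.
elim: X f g => [|x X IH] f g /=; first by ring.
by rewrite (IH (pushf x f) (pushf x g)); ring.
Qed.

Lemma contractZ r a f X : contract r (fun W => a * f W) X = a * contract r f X.
Proof.
elim: X f => [|x X IH] f /=; first by ring.
by rewrite (IH (pushf x f)); ring.
Qed.

Lemma contract0 r f X :
  (forall W, (size W).+1 = size X -> f W = 0) -> contract r f X = 0.
Proof.
elim: X f => //= x X IH f h; rewrite h // IH ?mulr0 ?subr0 // => W hW.
by apply: h; rewrite /= hW.
Qed.

Lemma contract_cat r f J X : contract r f (J ++ X) =
  contract r (fun W => f (W ++ X)) J +
  (-1) ^+ size J * contract r (fun W => f (J ++ W)) X.
Proof.
elim: J f => [|x J IH] f /=; first by rewrite add0r mul1r.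
by rewrite IH /pushf exprS; ring.
Qed.

Lemma exch_ext e f f' g g' Y :
  f =1 f' -> g =1 g' -> exch e f g Y = exch e f' g' Y.
Proof.
elim: Y f f' g g' => [|y Y IH] f f' g g' hf hg /=; first by rewrite hf hg.
by rewrite (IH f f' _ (pushf y g')) // ?(IH _ (pushf y f') g g') // => W;
   [apply: hf | apply: hg].
Qed.

Lemma exchDl e a b f f' g Y :
  exch e (fun J => a * f J + b * f' J) g Y = a * exch e f g Y + b * exch e f' g Y.
Proof.
elim: Y f f' g => [|y Y IH] f f' g /=; first by ring.
by rewrite IH (IH (pushf y f) (pushf y f')); ring.
Qed.

Lemma exchDr e a b f g g' Y :
  exch e f (fun J => a * g J + b * g' J) Y = a * exch e f g Y + b * exch e f g' Y.
Proof.
elim: Y f g g' => [|y Y IH] f g g' /=; first by ring.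
by rewrite IH (IH _ (pushf y g) (pushf y g')); ring.
Qed.

Lemma exchZl e a f g Y : exch e (fun J => a * f J) g Y = a * exch e f g Y.
Proof.
elim: Y f g => [|y Y IH] f g /=; first by ring.
by rewrite IH (IH (pushf y f)); ring.
Qed.

Lemma exch0 e f g Y :
  (forall J W, (size J + size W = size Y)%N -> f J * g W = 0) -> exch e f g Y = 0.
Proof.
elim: Y f g => [|y Y IH] f g h /=; first by rewrite h.
by rewrite !IH ?mulr0 ?addr0 // => J W hJ; apply: h => /=; lia.
Qed.

(** Every letter of [J] contributes one factor [e], so a sign per letter can be traded between [e]
    and [f]. *)
Lemma exch_sgn e f g Y :
  exch (- e) (fun J => (-1) ^+ size J * f J) g Y = exch e f g Y.
Proof.
elim: Y f g => [|y Y IH] f g /=; first by rewrite mul1r.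
rewrite IH; congr (_ + _).
rewrite -(IH (pushf y f)).
rewrite (@exch_ext _ (pushf y _) (fun J => (-1) * ((-1) ^+ size J * f (y :: J))) g g) //.
  by rewrite exchZl; ring.
by move=> J; rewrite /pushf /= exprS; ring.
Qed.

(** A letter removed from the complement of [J] is a letter removed from [Y]. The letters of [J] in
    front of it count only in the second sign, but each of them then has one letter fewer behind it,
    which compensates. *)
Lemma exch_contract_right e r f g Y :
  exch e f (contract r g) Y = contract r (exch e f g) Y.
Proof.
elim: Y f g => [|y Y IH] f g /=; first by rewrite mulr0.
rewrite (@exch_ext _ f f (pushf y (contract r g))
  (fun W => y r * g W + (-1) * contract r (pushf y g) W)) //; last first.
  by move=> W; rewrite /pushf /=; ring.
rewrite exchDr !IH.
rewrite [in RHS](@contract_ext r (pushf y (exch e f g))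
  (fun W => 1 * exch e f (pushf y g) W
          + (- (e * (-1) ^+ size Y)) * exch e (pushf y f) g W)); last first.
  by move=> W hW; rewrite /pushf /= -hW exprS; ring.
by rewrite contractD; ring.
Qed.

(** Both sides run over a letter of [Y] together with a splitting of the other letters; putting that
    letter into [J] or into the complement changes the sign by a factor that is the same for all
    terms. *)
Lemma exch_contract_left e r f g Y : e * e = 1 ->
  exch e (contract r f) g Y = - (e * (-1) ^+ size Y) * exch e f (contract r g) Y.
Proof.
move=> he; elim: Y f g => [|y Y IH] f g /=; first by rewrite mul0r !mulr0.
have P (h : wordfun) : pushf y (contract r h) =1
    (fun W => y r * h W + (-1) * contract r (pushf y h) W).
  by move=> W; rewrite /pushf /=; ring.
rewrite (exch_ext _ _ (P f) (fun=> erefl)) (exch_ext _ _ (fun=> erefl) (P g)).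
rewrite exchDl exchDr !IH exprS.
have hs : (-1) ^+ size Y * (-1) ^+ size Y = 1 :> rat by rewrite -expr2 sqrr_sign.
set s := (-1) ^+ size Y in hs *.
set A := exch e f _ Y; set B := exch e f g Y; set C := exch e (pushf y f) _ Y.
have -> : e * s * (y r * B + -1 * (- (e * s) * C)) = e * s * y r * B + (e * e) * (s * s) * C.
  by ring.
have -> : - (e * (-1 * s)) * (y r * B + -1 * A + e * s * C) =
  e * s * y r * B - e * s * A + (e * e) * (s * s) * C by ring.
by rewrite he hs; ring.
Qed.

(** In effect, the left contraction can be moved to the right, where two contractions along the same
    coordinate cancel. *)
Lemma exch_contract2 e r f g Y : e * e = 1 ->
  exch e (contract r f) (contract r g) Y = 0.
Proof.
move=> he; elim: Y f g => [|y Y IH] f g /=; first by rewrite mul0r.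
have P (h : wordfun) : pushf y (contract r h) =1
    (fun W => y r * h W + (-1) * contract r (pushf y h) W).
  by move=> W; rewrite /pushf /=; ring.
rewrite (exch_ext _ _ (P f) (fun=> erefl)) (exch_ext _ _ (fun=> erefl) (P g)).
by rewrite exchDl exchDr !IH exch_contract_left //; ring.
Qed.

(** The value of [e] pays for moving each letter of [J] past [X]; [exch] adds the sign for passing
    the later letters of [Y]. *)
Definition exchange_sum (F : wordfun) (X Y : seq letter) : rat :=
  exch ((-1) ^+ size X) (fun J => F (J ++ X)) F Y.

Lemma sqr_signr n : (-1) ^+ n * (-1) ^+ n = 1 :> rat.
Proof. by rewrite -expr2 sqrr_sign. Qed.

Lemma exch_contract_swap e r (f : seq letter -> wordfun) g X Y :
  exch e (fun J => contract r (f J) X) g Y =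
  contract r (fun W => exch e (fun J => f J W) g Y) X.
Proof.
elim: X f => [|x X IH] f /=; first by rewrite exch0 // => J W _; rewrite mul0r.
rewrite (@exch_ext _ _ (fun J => x r * f J X + (-1) * contract r (pushf x (f J)) X) g g) //.
  by rewrite exchDl (IH (fun J => pushf x (f J))) /pushf; ring.
by move=> J; ring.
Qed.

(** * Pluecker relations: vanishing of unbalanced exchange sums *)

Definition exchange_vanishing (F : wordfun) :=
  forall X Y, (size X + 2 <= size Y)%N -> exchange_sum F X Y = 0.

(** The contraction of [F (J ++ X)] hits [J] or [X]. In the first case both factors are contracted
    and [exch_contract2] applies. In the second, [X] and [Y] lose one letter each, so their lengths
    still differ by at least 2. *)
Lemma exchange_vanishing_contract r F :
  exchange_vanishing F -> exchange_vanishing (contract r F).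
Proof.
move=> hF X Y hXY; rewrite /exchange_sum.
rewrite (@exch_ext _ _ (fun J => 1 * contract r (fun W => F (W ++ X)) J +
  1 * ((-1) ^+ size J * contract r (fun W => F (J ++ W)) X)) _ (contract r F)) //;
  last by move=> J; rewrite contract_cat; ring.
rewrite exchDl exch_contract2 ?sqr_signr // -[X in exch X]opprK.
rewrite exch_sgn (exch_contract_swap _ _ (fun J W => F (J ++ W))).
rewrite contract0 ?mulr0 ?addr0 // => W hW; rewrite exch_contract_right.
rewrite contract0 // => Z hZ; rewrite -hW exprS mulN1r opprK.
by apply: hF; lia.
Qed.

Lemma exchange_vanishing_wdet n : exchange_vanishing (wdet n).
Proof.
elim: n => [|n IH]; last exact: exchange_vanishing_contract.
move=> X Y hXY; apply: exch0 => J W hJW /=.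
case: W hJW => [|w W] hJW; last by rewrite mulr0.
by case: J hJW => [|j J] hJW; [move: hJW => /=; lia | rewrite mul0r].
Qed.

(** * Adjoining an optional column to an alternating function *)

Definition alternating (f : wordfun) :=
  forall A x y B, f (A ++ x :: y :: B) = - f (A ++ y :: x :: B).

Lemma alternating_contract r f : alternating f -> alternating (contract r f).
Proof.
move=> hf A; elim: A f hf => [|a A IH] f hf x y B /=.
  have -> : contract r (pushf y (pushf x f)) B = - contract r (pushf x (pushf y f)) B.
    rewrite -mulN1r -contractZ; apply: contract_ext => W _.
    by rewrite /pushf mulN1r (hf [::]).
  by rewrite /pushf; ring.
by rewrite hf IH; [ring | move=> A' x' y' B'; apply: (hf (a :: A'))].
Qed.

Lemma alternating_wdet n : alternating (wdet n).
Proof.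
elim: n => [|n IH]; last exact: alternating_contract.
by move=> A x y B; rewrite /= /nilp !size_cat /= !addnS /= oppr0.
Qed.

Lemma alternating_shift f A J v X : alternating f ->
  f (A ++ J ++ v :: X) = (-1) ^+ size J * f (A ++ v :: J ++ X).
Proof.
move=> hf; elim: J A => [|x J IH] A /=; first by rewrite mul1r.
by have := IH (rcons A x); rewrite !cat_rcons => ->; rewrite hf exprS; ring.
Qed.

Lemma alternating_eq0 f A v J X : alternating f -> f (A ++ v :: J ++ v :: X) = 0.
Proof.
move=> hf; rewrite -cat_rcons alternating_shift // cat_rcons.
have /eqP := hf A v v (J ++ X); rewrite -subr_eq0 opprK -mulr2n mulrn_eq0 /= => /eqP ->.
by rewrite mulr0.
Qed.

Lemma exchange_sum_double F v X Y : alternating F -> exchange_sum F (v :: v :: X) Y = 0.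
Proof.
move=> hF; apply: exch0 => J W _.
by rewrite (@alternating_eq0 _ J v [::] X) // mul0r.
Qed.

Definition addcol (v : letter) (F : wordfun) : wordfun := fun X => F X + F (v :: X).

Lemma alternating_addcol v F : alternating F -> alternating (addcol v F).
Proof.
move=> hF A x y B; rewrite /addcol hF (hF (v :: A)) /=; ring.
Qed.

(** Expanding both factors gives four sums. With [v] only in the left factor one gets the sum for
    [v :: X]. With [v] only in the right factor one gets the sum for [v :: Y] without its terms
    having [v] in [J]; those are, up to sign, again the sum for [v :: X], whence the coefficient
    [1 - (-1) ^+ ...]. *)
Lemma exchange_sum_addcol F v X Y : alternating F ->
  exchange_sum (addcol v F) X Y = exchange_sum F X Y
    + (1 - (-1) ^+ (size X + size Y)) * exchange_sum F (v :: X) Y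
    + exchange_sum F X (v :: Y) + exchange_sum F (v :: X) (v :: Y).
Proof.
move=> hF; rewrite /exchange_sum /addcol /=.
set e := (-1) ^+ size X; set f := fun J => F (J ++ X).
set fv := fun J => F (v :: J ++ X); set gv := pushf v F.
(* Moving [v] past [J] costs one sign per letter of [J], absorbed by the additional sign that
   [v :: X] brings to [e]. *)
have hv : exch (-1 * e) (fun J => F (J ++ v :: X)) F Y = exch e fv F Y.
  rewrite mulN1r -[RHS]exch_sgn; apply: exch_ext => // J.
  by rewrite -[J ++ v :: X]cat0s alternating_shift.
have hv2 : exch (-1 * e) (fun J => F (J ++ v :: X)) gv Y = exch e fv gv Y.
  rewrite mulN1r -[RHS]exch_sgn; apply: exch_ext => // J.
  by rewrite -[J ++ v :: X]cat0s alternating_shift.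
have hz : exch (-1 * e) (pushf v (fun J => F (J ++ v :: X))) F Y = 0.
  apply: exch0 => J W _; rewrite /pushf /=.
  by rewrite (@alternating_eq0 _ [::] v J X) // mul0r.
rewrite exprS -/e hv hv2 hz.
rewrite (@exch_ext _ _ (fun J => 1 * f J + 1 * fv J) _ (fun W => 1 * F W + 1 * gv W));
  [|by move=> J; rewrite !mul1r|by move=> J; rewrite !mul1r].
rewrite exchDl !exchDr -/fv.
have -> : pushf v (fun J => F (J ++ X)) = fv by [].
by rewrite exprD -/e; ring.
Qed.

(** The one term that the hypothesis may miss is that of [v :: X] and [Y], when the lengths of [X]
    and [Y] differ by exactly 2; but then their sum is even and the coefficient is 0. *)
Lemma exchange_vanishing_addcol v F :
  alternating F -> exchange_vanishing F -> exchange_vanishing (addcol v F).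
Proof.
move=> hA hF X Y hXY; rewrite exchange_sum_addcol // hF // (hF X (v :: Y)) /=; last by lia.
rewrite (hF (v :: X) (v :: Y)) /=; last by lia.
rewrite !addr0 add0r; have [hlt|hge] := ltnP (size X + 2) (size Y).
  by rewrite hF ?mulr0 //=; lia.
have -> : (size X + size Y = (size X).+1.*2)%N by lia.
by rewrite -signr_odd odd_double subrr mul0r.
Qed.

(** This is F_n of the overview. *)
Fixpoint colsum (k : nat) (v : nat -> letter) (n : nat) : wordfun :=
  if n is n'.+1 then addcol (v n') (colsum k v n') else wdet k.

Lemma alternating_colsum k v n : alternating (colsum k v n).
Proof.
by elim: n => [|n IH]; [apply: alternating_wdet | apply: alternating_addcol].
Qed.

Lemma exchange_vanishing_colsum k v n : exchange_vanishing (colsum k v n).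
Proof.
elim: n => [|n IH]; first exact: exchange_vanishing_wdet.
exact: exchange_vanishing_addcol (alternating_colsum _ _ _) IH.
Qed.

(** * Additivity in each column *)

(** The sum is given pointwise, so that letters never have to be equal as functions. *)
Definition multilinear (f : wordfun) := forall A x y z B,
  (forall i, z i = x i + y i) -> f (A ++ z :: B) = f (A ++ x :: B) + f (A ++ y :: B).

Lemma multilinear_contract r f : multilinear f -> multilinear (contract r f).
Proof.
move=> hf A; elim: A f hf => [|a A IH] f hf x y z B hz /=.
  have -> : contract r (pushf z f) B = 1 * contract r (pushf x f) B + 1 * contract r (pushf y f) B.
    rewrite -contractD; apply: contract_ext => W _.
    by rewrite /pushf !mul1r (hf [::] x y).
  by rewrite hz; ring.
rewrite (hf _ x y) // (IH _ _ x y) //; first by ring.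
by move=> A' x' y' z' B'; apply: (hf (a :: A')).
Qed.

Lemma multilinear_wdet n : multilinear (wdet n).
Proof.
elim: n => [|n IH]; last exact: multilinear_contract.
by move=> A x y z B; rewrite /= /nilp !size_cat /= !addnS /= addr0.
Qed.

Lemma multilinear0 f A x B : multilinear f -> (forall i, x i = 0) -> f (A ++ x :: B) = 0.
Proof.
move=> hf hx; have /eqP := hf A x x x B (fun i => ltac:(rewrite !hx addr0 //)).
by rewrite -{1}[f _]addr0 (can_eq (addKr _)) eq_sym => /eqP.
Qed.

Lemma multilinear_eq f A x y B : multilinear f -> x =1 y -> f (A ++ x :: B) = f (A ++ y :: B).
Proof.
move=> hf hxy; rewrite (hf A y (fun=> 0) x) => [|i]; last by rewrite addr0.
by rewrite (multilinear0 A (x := fun=> 0)) ?addr0.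
Qed.

Lemma multilinear_addcol v f : multilinear f -> multilinear (addcol v f).
Proof.
move=> hf A x y z B hz; rewrite /addcol (hf _ x y) // (hf (v :: A) x y) //=; ring.
Qed.

Lemma multilinear_colsum k v n : multilinear (colsum k v n).
Proof.
by elim: n => [|n IH]; [apply: multilinear_wdet | apply: multilinear_addcol].
Qed.

Lemma wdet_size n X : size X != n -> wdet n X = 0.
Proof.
elim: n X => [|n IH] X; first by case: X.
move=> h; apply: contract0 => W hW; apply: IH; lia.
Qed.

Lemma exchange_sum_consD F x y z X Y : multilinear F -> (forall i, z i = x i + y i) ->
  exchange_sum F (z :: X) Y = exchange_sum F (x :: X) Y + exchange_sum F (y :: X) Y.
Proof.
move=> hF hz; rewrite /exchange_sum /=.
rewrite (@exch_ext _ _ (fun J => 1 * F (J ++ x :: X) + 1 * F (J ++ y :: X)) _ F) //.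
  by rewrite exchDl !mul1r.
by move=> J; rewrite (hF _ x y) // !mul1r.
Qed.

Lemma exchange_sum_cons0 F x X Y : multilinear F -> (forall i, x i = 0) -> exchange_sum F (x :: X) Y = 0.
Proof.
by move=> hF hx; apply: exch0 => J W _; rewrite multilinear0 ?mul0r.
Qed.

(** A nonzero term needs [k] letters both in [J ++ X] and in the complement of [J]; as [X] and [Y]
    are equally long, [J] is empty. *)
Lemma exchange_sum_wdet k X Y : size X = size Y -> exchange_sum (wdet k) X Y = wdet k X * wdet k Y.
Proof.
move=> hXY; rewrite /exchange_sum; set e := (-1) ^+ _; move: e => e.
have h0 J W : (size J + size W = size Y)%N -> (0 < size J)%N -> wdet k (J ++ X) * wdet k W = 0.
  move=> hJW hJ; have [hk|hk] := eqVneq (size W) k; last by rewrite (wdet_size hk) mulr0.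
  rewrite (@wdet_size k (J ++ X)) ?mul0r // size_cat.
  by lia.
suff H f g Z : (forall J W, (size J + size W = size Z)%N -> (0 < size J)%N -> f J * g W = 0) ->
    exch e f g Z = f [::] * g Z by rewrite H.
elim: Z f g => //= z Z IH f g h; rewrite IH; last first.
  by move=> J W hJW hJ; apply: h => //=; lia.
by rewrite exch0 ?mulr0 ?addr0 // => J W hJW; apply: h => //=; lia.
Qed.

Lemma exchange_sum_wdet_odd k X Y : odd (size X + size Y) -> exchange_sum (wdet k) X Y = 0.
Proof.
move=> hXY; apply: exch0 => J W hJW.
have [hk|hk] := eqVneq (size W) k; last by rewrite (wdet_size hk) mulr0.
by rewrite (@wdet_size k (J ++ X)) ?mul0r // size_cat; lia.
Qed.

(** * The sum over interlacing pairs is a square *)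

Definition word (n N : nat) (X : seq nat) : bool :=
  sorted ltn X && all (fun c => n <= c < N)%N X.

Lemma word_cons n N X : (n < N)%N -> word n.+1 N X -> word n N (n :: X).
Proof.
move=> hn /andP[hs ha]; apply/andP; split => /=.
  by rewrite path_sortedE ?hs ?andbT; [apply: sub_all ha => c; lia | exact: ltn_trans].
by rewrite leqnn hn /=; apply: sub_all ha => c; lia.
Qed.

Lemma word_weaken n n' N X : (n <= n')%N -> word n' N X -> word n N X.
Proof.
by move=> hn /andP[hs ha]; apply/andP; split => //; apply: sub_all ha => c; lia.
Qed.

Definition prevl (v : nat -> letter) (n : nat) : letter :=
  if n is n'.+1 then v n' else fun=> 0.

(* [E0 n X Y] stands for the pairs (T, S) of sets of rows with X, Y as their parts from
   row [n] on and equally many elements below [n]; in [E1 n X Y], T has one more there. *)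
Lemma interlacing_scan k N (v v' : nat -> letter) (E0 E1 : nat -> seq nat -> seq nat -> rat) :
  (forall n i, v' n i = v n i + prevl v n i) ->
  (forall X Y, word 0 N X -> word 0 N Y ->
     E0 0 X Y = wdet k (map v' X) * wdet k (map v Y) /\ E1 0 X Y = 0) ->
  (forall n X Y, (n < N)%N -> word n.+1 N X -> word n.+1 N Y ->
     E0 n.+1 X Y = E0 n X Y + (E0 n (n :: X) (n :: Y) + E1 n X (n :: Y)) /\
     E1 n.+1 X Y = E1 n X Y + E0 n (n :: X) Y) ->
  E0 N [::] [::] = colsum k v N [::] ^+ 2.
Proof.
move=> hv' hb hs.
(* The correction by [prevl v n] is dictated by [v']: in both recurrences it cancels the summand
   v_(n-1) that [E0] contributes at [n :: X]. *)
have H n X Y : (n <= N)%N -> word n N X -> word n N Y ->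
    (size X = size Y -> E0 n X Y = exchange_sum (colsum k v n) (map v' X) (map v Y)) /\
    (size Y = (size X).+1 -> E1 n X Y = exchange_sum (colsum k v n) (map v' X) (map v Y)
       - exchange_sum (colsum k v n) (prevl v n :: map v' X) (map v Y)).
  elim: n X Y => [|n IH] X Y hn hX hY.
    have [-> ->] := hb X Y hX hY; split => hsz.
      by rewrite exchange_sum_wdet ?size_map.
    rewrite exchange_sum_wdet_odd ?exchange_sum_cons0 ?subrr //=; first exact: multilinear_wdet.
    by rewrite !size_map hsz; lia.
  have [-> ->] := hs n X Y hn hX hY.
  have hX0 := word_weaken (leqnSn n) hX; have hY0 := word_weaken (leqnSn n) hY.
  have hX1 := word_cons hn hX; have hY1 := word_cons hn hY.
  have hn' := ltnW hn.
  set F := colsum k v n; have hF : alternating F by apply: alternating_colsum.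
  have hM : multilinear F by apply: multilinear_colsum.
  have hH : exchange_vanishing F by apply: exchange_vanishing_colsum.
  set X' := map v' X; set Y' := map v Y.
  have hc Z : exchange_sum F (v' n :: X') Z = exchange_sum F (v n :: X') Z + exchange_sum F (prevl v n :: X') Z.
    exact: exchange_sum_consD.
  split=> hsz.
    rewrite (proj1 (IH X Y hn' hX0 hY0)) // (proj1 (IH (n :: X) (n :: Y) hn' hX1 hY1)) /= ?hsz //.
    rewrite (proj2 (IH X (n :: Y) hn' hX0 hY1)) /= ?hsz //.
    rewrite /= exchange_sum_addcol // -/F -/X' -/Y' hc !size_map hsz.
    (* The lengths are equal, so the middle coefficient of [exchange_sum_addcol] is 0. *)
    by rewrite addnn -signr_odd odd_double expr0 subrr mul0r; ring.
  rewrite (proj2 (IH X Y hn' hX0 hY0)) // (proj1 (IH (n :: X) Y hn' hX1 hY0)) /= ?hsz //.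
  rewrite /= !exchange_sum_addcol // -/F -/X' -/Y' hc !exchange_sum_double //= !size_map hsz.
  (* Here the second word is longer by exactly 2: this is where the Pluecker relations enter. *)
  rewrite (hH X' (v n :: Y')) /=; last by rewrite !size_map; lia.
  rewrite addnS addnn -signr_odd /= odd_double /= expr1.
  by rewrite addSn addnS addnn -signr_odd /= odd_double /= expr0; ring.
by rewrite (proj1 (H N [::] [::] (leqnn N) isT isT)).
Qed.

Fixpoint increasing_words (n : nat) : seq (seq nat) :=
  if n is n'.+1 then increasing_words n' ++ [seq rcons l n' | l <- increasing_words n'] else [:: [::]].

Lemma colsum_increasing_words k v n X :
  colsum k v n X = \sum_(l <- increasing_words n) wdet k (map v l ++ X).
Proof.
elim: n X => [|n IH] X /=; first by rewrite big_seq1.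
rewrite /addcol !IH big_cat big_map /=; congr (_ + _).
by apply: eq_bigr => l _; rewrite map_rcons cat_rcons.
Qed.

Lemma word_pairwise n N X :
  word n N X = pairwise ltn X && all (fun c => n <= c < N)%N X.
Proof. by rewrite /word sorted_pairwise //; exact: ltn_trans. Qed.

Lemma mem_increasing_words n l : (l \in increasing_words n) = word 0 n l.
Proof.
elim: n l => [|n IH] l /=.
  by rewrite inE; case: l => // x l; rewrite /word /= andbF.
rewrite mem_cat IH !word_pairwise; case/lastP: l => [|l x] //.
rewrite pairwise_rcons !all_rcons; apply/orP/idP => [[|/mapP[l' + /rcons_inj[-> ->]]]|].
- case/andP => /andP[-> ->] /andP[h1 h2] /=; apply/andP; split; first by lia.
  by apply: sub_all h2 => c; lia.
- rewrite IH word_pairwise => /andP[-> h2]; rewrite andbT.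
  by apply/andP; split; [|apply/andP; split; first lia]; apply: sub_all h2 => c; lia.
case/andP => /andP[h1 h2] /andP[h3 h4].
have [->|hx] := eqVneq x n; [right | left].
- apply: map_f; rewrite IH word_pairwise h2 /=; apply/allP => c hc.
  by have := allP h1 c hc; have := allP h4 c hc; lia.
- rewrite h1 h2 /=; apply/andP; split; first by lia.
  by apply/allP => c hc; have := allP h1 c hc; have := allP h4 c hc; lia.
Qed.

Lemma uniq_increasing_words n : uniq (increasing_words n).
Proof.
elim: n => //= n IH; rewrite cat_uniq IH map_inj_uniq => [|l l' /rcons_inj[]//].
rewrite IH andbT /=; apply/hasPn => l /mapP[l' _ ->].
rewrite mem_increasing_words word_pairwise all_rcons; lia.
Qed.

(** * Adjacency of unit triangles *)

(** Vertices of unit triangles have coordinates shifted by 0 or 1, so these comparisons decide edge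
    sharing, which becomes a finite Boolean table. *)
Lemma int_shift_cases (x y : int) :
  [/\ x == y, x == y + 1 = false & x + 1 == y = false] \/
  [/\ x == y = false, x == y + 1 & x + 1 == y = false] \/
  [/\ x == y = false, x == y + 1 = false & x + 1 == y] \/
  [/\ x == y = false, x == y + 1 = false & x + 1 == y = false].
Proof.
have [->|h1] := eqVneq x y; first by left; split=> //; lia.
have [->|h2] := eqVneq x (y + 1); first by right; left; split=> //; lia.
have [h3|h3] := eqVneq (x + 1) y; first by right; right; left; split.
by right; right; right; split.
Qed.

Lemma share_edge_RL a b a' b' : share_edge (Rtri a b) (Ltri a' b') =
  [|| (a == a') && (b == b'), (a == a' + 1) && (b == b') | (a == a') && (b == b' + 1)].
Proof.
rewrite /share_edge /= !inE !xpair_eqE !(can_eq (addrK 1)).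
by case: (int_shift_cases a a') => [[-> -> ->]|[[-> -> ->]|[[-> -> ->]|[-> -> ->]]]];
   case: (int_shift_cases b b') => [[-> -> ->]|[[-> -> ->]|[[-> -> ->]|[-> -> ->]]]].
Qed.

Lemma share_edge_LR a b a' b' : share_edge (Ltri a' b') (Rtri a b) =
  [|| (a == a') && (b == b'), (a == a' + 1) && (b == b') | (a == a') && (b == b' + 1)].
Proof.
rewrite /share_edge /= !inE !xpair_eqE !(can_eq (addrK 1)) ![a' == _]eq_sym ![b' == _]eq_sym.
rewrite ![a' + 1 == _]eq_sym ![b' + 1 == _]eq_sym.
by case: (int_shift_cases a a') => [[-> -> ->]|[[-> -> ->]|[[-> -> ->]|[-> -> ->]]]];
   case: (int_shift_cases b b') => [[-> -> ->]|[[-> -> ->]|[[-> -> ->]|[-> -> ->]]]].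
Qed.

Lemma share_edge_RR a b a' b' : share_edge (Rtri a b) (Rtri a' b') = false.
Proof.
rewrite /share_edge /= !inE !xpair_eqE !(can_eq (addrK 1)).
by case: (int_shift_cases a a') => [[-> -> ->]|[[-> -> ->]|[[-> -> ->]|[-> -> ->]]]];
   case: (int_shift_cases b b') => [[-> -> ->]|[[-> -> ->]|[[-> -> ->]|[-> -> ->]]]].
Qed.

Lemma share_edge_LL a b a' b' : share_edge (Ltri a b) (Ltri a' b') = false.
Proof.
rewrite /share_edge /= !inE !xpair_eqE !(can_eq (addrK 1)).
by case: (int_shift_cases a a') => [[-> -> ->]|[[-> -> ->]|[[-> -> ->]|[-> -> ->]]]];
   case: (int_shift_cases b b') => [[-> -> ->]|[[-> -> ->]|[[-> -> ->]|[-> -> ->]]]].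
Qed.

Lemma share_edgeC t u : share_edge t u = share_edge u t.
Proof.
by case: t u => a b [] a' b';
   rewrite ?share_edge_RL ?share_edge_LR ?share_edge_RR ?share_edge_LL.
Qed.

Lemma share_edge_irr t : share_edge t t = false.
Proof. by case: t => a b; rewrite ?share_edge_RR ?share_edge_LL. Qed.

(** * Tilings by removal of one lozenge *)

Section Matching.
Variables (A : {fset triangle}) (w : {fset triangle} -> rat).
Implicit Types (t u : A) (B : {set A}).

(** Arbitrary sets [B] of triangles are allowed, so that what is left after removing lozenges is
    again of this form. *)
Definition matching_gf B : rat :=
  \sum_(T : {set {set A}} | partition T B && [forall l in T, is_lozenge l])
     \prod_(l in T) w [fset val t | t in l]%fset.

Lemma matching_gf_setT : tiling_gf A w = matching_gf [set: A].
Proof. by []. Qed.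

Lemma matching_gf0 : matching_gf set0 = 1.
Proof.
rewrite /matching_gf (big_pred1 set0) ?big_set0 // => T.
rewrite partition_set0 inE; case: (eqVneq T set0) => [->|//] /=.
by apply/forall_inP => l; rewrite inE.
Qed.

Lemma is_lozenge_pair t u : is_lozenge [set t; u] = share_edge (val t) (val u).
Proof.
apply/existsP/idP => [[x /existsP[y /andP[/eqP h s]]]|s]; last first.
  by exists t; apply/existsP; exists u; rewrite eqxx.
have xy : x != y by apply: contraTneq s => ->; rewrite share_edge_irr.
have := set21 t u; rewrite h => /set2P hx; have := set22 t u; rewrite h => /set2P hy.
have := set21 x y; rewrite -h => /set2P hx'; have := set22 x y; rewrite -h => /set2P hy'.
case: hx => ex; case: hy => ey; subst => //.
- by case: hy' xy => ->; rewrite eqxx.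
- by rewrite share_edgeC.
- by case: hx' xy => ->; rewrite eqxx.
Qed.

Lemma matching_gf_rec B t : t \in B ->
  matching_gf B = \sum_(u in B | share_edge (val t) (val u))
     w [fset val t; val u]%fset * matching_gf (B :\: [set t; u]).
Proof.
move=> tB; rewrite /matching_gf.
(* The block of [t] is a lozenge with a unique partner [u], so the inserted indicators add up to 1;
   after exchanging the sums, tilings containing this block are reindexed by deleting it. *)
transitivity (\sum_(T : {set {set A}} | partition T B && [forall l in T, is_lozenge l])
  \sum_(u in B | share_edge (val t) (val u)) ([set t; u] \in T)%:R *
     \prod_(l in T) w [fset val t | t in l]%fset).
  apply: eq_bigr => T /andP[pT /forall_inP lT].
  have tT : t \in cover T by rewrite (cover_partition pT).
  have bT := pblock_mem tT; have /existsP[x /existsP[y /andP[/eqP exy sxy]]] := lT _ bT.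
  have tb : t \in pblock T t by rewrite mem_pblock.
  have [u eu su] : exists2 u, pblock T t = [set t; u] & share_edge (val t) (val u).
    move: tb; rewrite exy => /set2P[->|->]; first by exists y.
    by exists x; [rewrite setUC | rewrite share_edgeC].
  have uB : u \in B by apply: (subsetP (partitionS pT bT)); rewrite eu set22.
  rewrite (bigD1 u) ?uB //= -eu bT mul1r [X in _ + X]big1 ?addr0 // => u' /andP[/andP[u'B su'] nu].
  case: (boolP ([set t; u'] \in T)) => [h|]; last by rewrite mul0r.
  have := def_pblock (partition_trivIset pT) h (set21 t u'); rewrite eu => e.
  have : u' \in [set t; u] by rewrite e set22.
  case/set2P => e'; last by rewrite e' eqxx in nu.
  by rewrite e' share_edge_irr in su'.
rewrite exchange_big /=; apply: eq_bigr => u /andP[uB stu].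
have tu : t != u by apply: contraTneq stu => ->; rewrite share_edge_irr.
set l := [set t; u]; rewrite (bigID (fun T : {set {set A}} => l \in T)) /=.
rewrite [X in _ + X]big1 ?addr0; last by move=> T /andP[_ /negbTE ->]; rewrite mul0r.
rewrite (reindex_onto (fun T' => l |: T') (fun T => T :\ l)) /=; last first.
  by move=> T /andP[_ hl]; rewrite setD1K.
have lB : l \subset B by apply/subsetP => x /set2P[] ->.
have l0 : l != set0 by apply/set0Pn; exists t; rewrite set21.
rewrite big_distrr /=; apply: eq_big => T.
  rewrite setU11 andbT; apply/andP/andP => [[/andP[pT lT] /eqP hT]|[pT lT]].
    rewrite -hT; split; first exact: partitionD1 pT (setU11 _ _).
    apply/forall_inP => x /setD1P[_ hx]; exact: (forall_inP lT).
  have lnT : l \notin T.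
    apply/negP => lT'; have /subsetP/(_ t (set21 _ _)) := partitionS pT lT'.
    by rewrite inE set21.
  split; last by rewrite setU1K.
  apply/andP; split.
    have dl : [disjoint l & B :\: l].
      by rewrite -setI_eq0; apply/eqP/setP => x; rewrite !in_set andbA andbN.
    have hB : l :|: B :\: l = B by rewrite -{1}(setIidPr lB) setID.
    by have := partitionU1 pT l0 dl; rewrite hB.
  apply/forall_inP => x /setU1P[->|hx]; first by rewrite is_lozenge_pair.
  exact: (forall_inP lT).
case/andP => /andP[/andP[pT lT] _] /eqP hT.
rewrite setU11 mul1r (bigD1 l) ?setU11 //=; congr (_ * _).
  congr w; apply/fsetP => x; rewrite !inE.
  apply/imfsetP/orP => [[y /=]|].
    by case/set2P => -> ->; [left|right].
  by case=> /eqP ->; [exists t | exists u]; rewrite ?set21 ?set22.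
apply: eq_bigl => x; rewrite -[in RHS]hT !inE; case: (x == l) => //=; rewrite ?andbF ?andbT //.
Qed.

End Matching.

(** * Conjugate parts and coordinates on the region *)

(** The [d]-th part of the conjugate partition. It is also the number of paths crossing the line at
    distance [d], hence the size of the minor there. *)
Definition parts_ge (lam : seq nat) (d : nat) : nat := count (leq d) lam.

Section Parts.
Variable lam : seq nat.
Hypothesis hlam : is_strict_partition lam.

Lemma leq_parts_ge d i : (0 < i <= size lam)%N -> (i <= parts_ge lam d)%N = (d <= part lam i)%N.
Proof.
move=> hi; have e : lam = map (part lam) (iota 1 (size lam)).
  apply: (@eq_from_nth _ 0) => [|j hj]; first by rewrite size_map size_iota.
  by rewrite (nth_map 0) ?size_iota // nth_iota // add1n.
rewrite /parts_ge {1}e count_map count_initial /=; try lia.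
move=> a b a0 ab bk; have := @part_strict lam a b hlam; lia.
Qed.

Lemma parts_ge_size d : (parts_ge lam d <= size lam)%N.
Proof. exact: count_size. Qed.

Lemma part_pos i : (0 < i <= size lam)%N -> (0 < part lam i)%N.
Proof. by move=> hi; have /andP[_ h] := hlam; have := @Defs.part_gt0 lam i h; rewrite hi. Qed.

Lemma parts_ge1 : parts_ge lam 1 = size lam.
Proof.
have [h0|k0] := eqVneq (size lam) 0%N; last first.
  apply/eqP; rewrite eqn_leq parts_ge_size /= leq_parts_ge; last by lia.
  by apply: part_pos; lia.
by have := parts_ge_size 1; lia.
Qed.

Lemma parts_ge0 : parts_ge lam 0 = size lam.
Proof. by apply/eqP; rewrite -all_count; apply/allP. Qed.

Lemma parts_ge_anti d d' : (d <= d')%N -> (parts_ge lam d' <= parts_ge lam d)%N.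
Proof. by move=> h; apply: sub_count => x /=; apply: leq_trans. Qed.

(** The parts are distinct, so at most one of them equals [d]. *)
Lemma parts_ge_step d : (parts_ge lam d <= (parts_ge lam d.+1).+1)%N.
Proof.
rewrite leqNgt; apply/negP => h; have hs := parts_ge_size d.
have h1 := @leq_parts_ge d (parts_ge lam d.+1).+2 ltac:(lia).
have h2 := @leq_parts_ge d.+1 (parts_ge lam d.+1).+1 ltac:(lia).
have := @part_strict lam (parts_ge lam d.+1).+1 (parts_ge lam d.+1).+2 hlam; lia.
Qed.

Lemma parts_ge_max d : (part lam 1 < d)%N -> parts_ge lam d = 0%N.
Proof.
move=> h; apply/eqP; rewrite -leqn0 leqNgt; apply/negP => h1.
have := @leq_parts_ge d 1; have := parts_ge_size d; lia.
Qed.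

Lemma parts_ge_part i : (0 < i <= size lam)%N ->
  parts_ge lam (part lam i) = i /\ parts_ge lam (part lam i).+1 = i.-1.
Proof.
move=> hi; have h1 : (i <= parts_ge lam (part lam i))%N by rewrite leq_parts_ge.
have h2 : (parts_ge lam (part lam i).+1 < i)%N by rewrite ltnNge leq_parts_ge //; lia.
have := parts_ge_step (part lam i); lia.
Qed.

Lemma part_parts_ge d : (parts_ge lam d.+1 < parts_ge lam d)%N -> part lam (parts_ge lam d) = d.
Proof.
move=> h; have hs := parts_ge_size d.
have := @leq_parts_ge d (parts_ge lam d) ltac:(lia); have := @leq_parts_ge d.+1 (parts_ge lam d) ltac:(lia).
lia.
Qed.

Lemma part_le1 i : (0 < i <= size lam)%N -> (part lam i <= part lam 1)%N.
Proof. by move=> h; have := @part_strict lam 1 i hlam; lia. Qed.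

End Parts.

(* (s, i, d, c): side (true = right half), inner/outer triangle of the column at
   distance d from the centre, bent row c *)
Definition code : Type := (bool * bool * nat * nat)%type.

(** The right half is sheared so that a bent row has the same [c] on both sides and the two halves
    get the same adjacency rules. *)
Definition enc (x : code) : triangle :=
  let: (s, i, d, c) := x in
  if s then if i then Rtri d%:Z (c%:Z - d%:Z) else Ltri d%:Z (c%:Z - d%:Z - 1)
  else if i then Ltri (- d%:Z) c%:Z else Rtri (- d%:Z) c%:Z.

Definition dec (t : triangle) : code :=
  match t with
  | Rtri a b => if 0 <= a then (true, true, absz a, absz (b + a))
                else (false, false, absz a, absz b)
  | Ltri a b => if 0 <= a then (true, false, absz a, absz (b + a + 1))
                else (false, true, absz a, absz b)
  end.

(** In the row [c = size lam - i], inner triangles reach distance [part lam i] and outer ones stop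
    one column earlier; in terms of [c] these are the two lower bounds. The central column [d = 0]
    is filed under the right half. *)
Definition in_region (m : nat) (lam : seq nat) (x : code) : bool :=
  let: (s, i, d, c) := x in
  [&& (size lam - parts_ge lam (if i then d else d.+1) <= c)%N, (c < m + size lam)%N,
      (d <= part lam 1)%N & s || (0 < d)%N].

(** Two inner triangles meet only across the border between the central column and the left half;
    all other adjacent pairs consist of an inner and an outer triangle on the same side. *)
Definition adjc (x y : code) : bool :=
  let: (s, i, d, c) := x in let: (s', i', d', c') := y in
  (if i then
    if i' then (c == c') && (if s then [&& ~~ s', d == 0 & d' == 1] else [&& s', d' == 0 & d == 1])
    else (s == s') && [|| (d == d') && (c == c'), (d == d') && (c' == c.+1) | (d == d'.+1) && (c == c')]
  else if i' then (s == s') && [|| (d == d') && (c == c'), (d == d') && (c == c'.+1) | (d' == d.+1) && (c == c')]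
  else false)%N.

Lemma decK x : (x.1.1.1 || (0 < x.1.2))%N -> dec (enc x) = x.
Proof.
case: x => [[[[] []] d] c] //= h.
- by congr (_, _, _, _); lia.
- by congr (_, _, _, _); lia.
- by rewrite ifF; [congr (_, _, _, _)|]; lia.
- by rewrite ifF; [congr (_, _, _, _)|]; lia.
Qed.

Lemma share_edge_enc x y : (x.1.1.1 || (0 < x.1.2))%N -> (y.1.1.1 || (0 < y.1.2))%N ->
  share_edge (enc x) (enc y) = adjc x y.
Proof.
case: x => [[[[] []] d] c]; case: y => [[[[] []] d'] c'] //= h h';
  rewrite ?share_edge_RL ?share_edge_LR ?share_edge_RR ?share_edge_LL //; lia.
Qed.

Lemma mem_region m lam t : t \in region_A m lam <->
  (exists c, (size lam)%:Z <= c <= m%:Z + (size lam)%:Z - 1 /\ t \in upper_row lam c) \/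
  (exists i, (0 < i <= size lam)%N /\ t \in lower_row lam i).
Proof.
have -> : (t \in region_A m lam) = (t \in
    flatten [seq upper_row lam c | c <- int_range (size lam)%:Z (m%:Z + (size lam)%:Z - 1)] ++
    flatten [seq lower_row lam i | i <- iota 1 (size lam)]) by rewrite in_fset.
rewrite mem_cat; split.
  case/orP => /flattenP[s /mapP[x]].
    by rewrite mem_int_range => hx -> ht; left; exists x.
  by rewrite mem_iota => hx -> ht; right; exists x; split=> //; lia.
case=> [[c [hc ht]]|[i [hi ht]]]; apply/orP; [left|right]; apply/flattenP.
  by exists (upper_row lam c) => //; apply: map_f; rewrite mem_int_range.
by exists (lower_row lam i) => //; apply: map_f; rewrite mem_iota; lia.
Qed.

Lemma mem_mapR (f : int -> int) a b x y :
  (Rtri x y \in [seq Rtri z (f z) | z <- int_range a b]) = [&& a <= x, x <= b & y == f x].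
Proof.
apply/mapP/and3P => [[z]|[h1 h2 /eqP ->]].
  by rewrite mem_int_range => /andP[h1 h2] [-> ->].
by exists x => //; rewrite mem_int_range h1.
Qed.

Lemma mem_mapL (f : int -> int) a b x y :
  (Ltri x y \in [seq Ltri z (f z) | z <- int_range a b]) = [&& a <= x, x <= b & y == f x].
Proof.
apply/mapP/and3P => [[z]|[h1 h2 /eqP ->]].
  by rewrite mem_int_range => /andP[h1 h2] [-> ->].
by exists x => //; rewrite mem_int_range h1.
Qed.

Lemma mem_mapRL (f : int -> int) s x y : (Rtri x y \in [seq Ltri z (f z) | z <- s]) = false.
Proof. by apply/negP => /mapP[]. Qed.

Lemma mem_mapLR (f : int -> int) s x y : (Ltri x y \in [seq Rtri z (f z) | z <- s]) = false.
Proof. by apply/negP => /mapP[]. Qed.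

Lemma mem_upperR lam c x y : (Rtri x y \in upper_row lam c) =
  [&& - (part lam 1)%:Z <= x, x <= -1 & y == c] || [&& 0 <= x, x <= (part lam 1)%:Z & y == c - x].
Proof.
by rewrite /upper_row !mem_cat (mem_mapR (fun=> c)) (mem_mapRL (fun=> c))
  (mem_mapR (fun a => c - a)) (mem_mapRL (fun a => c - a - 1)) orbF.
Qed.

Lemma mem_upperL lam c x y : (Ltri x y \in upper_row lam c) =
  [&& - (part lam 1)%:Z <= x, x <= -1 & y == c] || [&& 0 <= x, x <= (part lam 1)%:Z & y == c - x - 1].
Proof.
by rewrite /upper_row !mem_cat (mem_mapL (fun=> c)) (mem_mapLR (fun=> c))
  (mem_mapLR (fun a => c - a)) (mem_mapL (fun a => c - a - 1)).
Qed.

Lemma Rtri_eq a b a' b' : (Rtri a b == Rtri a' b') = (a == a') && (b == b').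
Proof. by apply/eqP/andP => [[-> ->]|[/eqP -> /eqP ->]]. Qed.

Lemma LRtri_eq a b a' b' : (Ltri a b == Rtri a' b') = false.
Proof. by apply/eqP. Qed.

Lemma mem_lowerR lam i x y : let c := (size lam)%:Z - i%:Z in let li := (part lam i)%:Z in
  (Rtri x y \in lower_row lam i) =
  [|| [&& - li + 1 <= x, x <= -1 & y == c], [&& 0 <= x, x <= li - 1 & y == c - x]
    | (x == li) && (y == c - li)].
Proof.
move=> c li; rewrite /lower_row !mem_cat inE -/c -/li (mem_mapR (fun=> c)) (mem_mapRL (fun=> c))
  (mem_mapR (fun a => c - a)) (mem_mapRL (fun a => c - a - 1)) Rtri_eq //.
Qed.

Lemma mem_lowerL lam i x y : let c := (size lam)%:Z - i%:Z in let li := (part lam i)%:Z in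
  (Ltri x y \in lower_row lam i) =
  [&& - li <= x, x <= -1 & y == c] || [&& 0 <= x, x <= li - 1 & y == c - x - 1].
Proof.
move=> c li; rewrite /lower_row !mem_cat inE -/c -/li (mem_mapL (fun=> c)) (mem_mapLR (fun=> c))
  (mem_mapLR (fun a => c - a)) (mem_mapL (fun a => c - a - 1)) LRtri_eq orbF //.
Qed.

Lemma in_region_side m lam x : in_region m lam x -> (x.1.1.1 || (0 < x.1.2))%N.
Proof. by case: x => [[[s i] d] c] /and4P[]. Qed.

Lemma in_region_enc m lam x : is_strict_partition lam -> in_region m lam x -> enc x \in region_A m lam.
Proof.
move=> hl; case: x => [[[s i] d] c] /and4P[h1 h2 h3 h4].
apply/mem_region; have [hc|hc] := leqP (size lam) c.
  left; exists c%:Z; split; first by lia.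
  by case: s h4 => h4; case: i h1 => h1 /=; rewrite ?mem_upperR ?mem_upperL; lia.
right; exists (size lam - c)%N; split; first by lia.
have e := @leq_parts_ge lam hl (if i then d else d.+1) (size lam - c)%N ltac:(lia).
have e2 := @part_pos lam hl (size lam - c)%N ltac:(lia).
by case: s h4 => h4; case: i h1 e => h1 e /=; rewrite ?mem_lowerR ?mem_lowerL; lia.
Qed.

Lemma in_region_dec m lam t : is_strict_partition lam -> t \in region_A m lam ->
  in_region m lam (dec t) /\ enc (dec t) = t.
Proof.
move=> hl /mem_region[[c [hc]]|[i [hi]]].
  case: t => a b; rewrite ?mem_upperR ?mem_upperL /dec => h.
    case: ifP => ha; split; rewrite /in_region /enc /=; try (congr Rtri; lia).
      have := parts_ge_size lam (absz a); lia.
    have := parts_ge_size lam (absz a).+1; lia.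
  case: ifP => ha; split; rewrite /in_region /enc /=; try (congr Ltri; lia).
    have := parts_ge_size lam (absz a).+1; lia.
  have := parts_ge_size lam (absz a); lia.
have hp := part_le1 hl hi; have hp0 := part_pos hl hi.
case: t => a b; rewrite ?mem_lowerR ?mem_lowerL /dec => h.
  case: ifP => ha; split; rewrite /in_region /enc /=; try (congr Rtri; lia).
    have := @leq_parts_ge lam hl (absz a) i hi; lia.
  have := @leq_parts_ge lam hl (absz a).+1 i hi; lia.
case: ifP => ha; split; rewrite /in_region /enc /=; try (congr Ltri; lia).
  have := @leq_parts_ge lam hl (absz a).+1 i hi; lia.
have := @leq_parts_ge lam hl (absz a) i hi; lia.
Qed.

Lemma RLtri_eq a b a' b' : (Rtri a b == Ltri a' b') = false.
Proof. by apply/eqP. Qed.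

Lemma weight_LR lam a b a' b' : weight_A lam [fset Ltri a b; Rtri a' b']%fset =
  if has (fun i => [&& a == (part lam i)%:Z - 1, a' == (part lam i)%:Z,
                       b == (size lam)%:Z - i%:Z - (part lam i)%:Z & b' == b]) (iota 1 (size lam))
  then 1 / 2 else 1.
Proof.
rewrite /weight_A; congr (if _ then _ else _); apply/mapP/hasP => [[i hi e]|[i hi]].
  exists i => //; move: e; rewrite /half_lozenge => /fsetP e.
  have := e (Ltri a b); rewrite !inE eqxx /= LRtri_eq orbF => /esym/eqP[-> ->].
  have := e (Rtri a' b'); rewrite !inE eqxx orbT RLtri_eq => /esym/eqP[-> ->].
  by rewrite !eqxx.
case/and4P => /eqP -> /eqP -> /eqP -> /eqP ->; exists i => //.
Qed.

Definition wgt (lam : seq nat) (x y : code) : rat := weight_A lam [fset enc x; enc y]%fset.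

Lemma wgtC lam x y : wgt lam x y = wgt lam y x.
Proof. by rewrite /wgt fsetUC. Qed.

(** Here [d] is a part and [c] is the lowest row of the line at distance [d]; on the right, the
    lozenge crossing the line there is the one of weight 1/2. *)
Definition special (lam : seq nat) (d c : nat) : bool :=
  (parts_ge lam d.+1 < parts_ge lam d)%N && (c == size lam - parts_ge lam d)%N.

Lemma wgt_outer lam s d c : is_strict_partition lam ->
  wgt lam (s, false, d, c) (s, true, d.+1, c) =
  if s && special lam d.+1 c then 1 / 2 else 1.
Proof.
move=> hl; case: s; rewrite /wgt /enc /=; last first.
  rewrite fsetUC weight_LR; case: hasP => // -[i]; rewrite mem_iota => hi /and4P[].
  by have := @part_pos lam hl i; lia.
rewrite weight_LR; congr (if _ then _ else _); apply/hasP/idP => [[i]|/andP[h1 h2]].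
  rewrite mem_iota => hi /and4P[h1 h2 h3 h4].
  have [e1 e2] := @parts_ge_part lam hl i ltac:(lia).
  have <- : part lam i = d.+1 by lia.
  by rewrite /special e1 e2; lia.
have hs := parts_ge_size lam d.+1; have hp := part_parts_ge hl h1.
exists (parts_ge lam d.+1); first by rewrite mem_iota; lia.
by rewrite hp; lia.
Qed.

Lemma wgt_same lam s d c c' : wgt lam (s, true, d, c) (s, false, d, c') = 1.
Proof.
case: s; rewrite /wgt /enc ?[[fset Rtri _ _; _]%fset]fsetUC weight_LR;
  case: hasP => // -[i _ /and4P[]]; lia.
Qed.

Lemma wgt_center lam c : is_strict_partition lam ->
  wgt lam (true, true, 0%N, c) (false, true, 1%N, c) = 1.
Proof.
move=> hl; rewrite /wgt /enc fsetUC weight_LR; case: hasP => // -[i].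
by rewrite mem_iota => hi /and4P[]; have := @part_pos lam hl i; lia.
Qed.

Section CodeMatching.
Variables (m : nat) (lam : seq nat).
Hypothesis hlam : is_strict_partition lam.
Local Notation in_region := (in_region m lam).
Local Notation wgt := (wgt lam).

Definition subregion_gf (p : pred code) : rat :=
  @matching_gf (region_A m lam) (weight_A lam) [set x | p (dec (val x))].

Lemma subregion_gf_ext p q : (forall x, in_region x -> p x = q x) -> subregion_gf p = subregion_gf q.
Proof.
move=> h; congr matching_gf; apply/setP => x; rewrite !inE; apply: h.
by have [] := in_region_dec hlam (valP x).
Qed.

Lemma subregion_gf_pred0 (p : pred code) : (forall x, in_region x -> p x = false) -> subregion_gf p = 1.
Proof.
move=> h; rewrite (@subregion_gf_ext p pred0) // /subregion_gf -[RHS](@matching_gf0 (region_A m lam) (weight_A lam)).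
by congr matching_gf; apply/setP => x; rewrite !inE.
Qed.

Lemma subregion_gf_predT (p : pred code) : (forall x, in_region x -> p x) -> M_A m lam = subregion_gf p.
Proof.
move=> h; rewrite /M_A matching_gf_setT; congr matching_gf; apply/setP => x; rewrite !inE h //.
by have [] := in_region_dec hlam (valP x).
Qed.

Lemma subregion_gf_rec (p : pred code) t s : in_region t -> p t -> uniq s ->
  (forall u, u \in s -> in_region u -> adjc t u) ->
  (forall u, in_region u -> p u -> adjc t u -> u \in s) ->
  subregion_gf p = \sum_(u <- s) (if in_region u && p u then
     wgt t u * subregion_gf (fun x => [&& p x, x != t & x != u]) else 0).
Proof.
move=> ht pt us h1 h2; rewrite -big_mkcond /=.
have hA := in_region_enc hlam ht; pose t0 : region_A m lam := Sub (enc t) hA.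
have dK u : in_region u -> dec (enc u) = u by move/in_region_side/decK.
have dv (x : region_A m lam) : in_region (dec (val x)) by have [] := in_region_dec hlam (valP x).
have ev (x : region_A m lam) : enc (dec (val x)) = val x by have [] := in_region_dec hlam (valP x).
rewrite /subregion_gf (matching_gf_rec _ (t := t0)); last by rewrite inE /= dK.
rewrite -[RHS]big_filter.
rewrite (perm_big [seq dec (val u) | u <- enum [pred u : region_A m lam |
   (u \in [set x | p (dec (val x))]) && share_edge (val t0) (val u)]]) /=.
  rewrite big_map big_enum /=; apply: eq_big => // u; rewrite !inE => /andP[pu su].
  rewrite /wgt ev; congr (_ * matching_gf _ _).
  apply/setP => x; rewrite !inE negb_or andbC; congr (_ && _).
  rewrite -(inj_eq val_inj) -[x == u](inj_eq val_inj) /=; congr (~~ _ && ~~ _).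
    apply/eqP/eqP => [->|e]; [by rewrite dK | by rewrite -e ev].
  by apply/eqP/eqP => [->//|e]; rewrite -[LHS]ev e ev.
rewrite perm_sym; apply: uniq_perm.
- by rewrite map_inj_uniq ?enum_uniq // => x y e; apply: val_inj; rewrite -(ev x) -(ev y) e.
- exact: filter_uniq.
move=> u; rewrite mem_filter; apply/mapP/andP => [[x]|[/andP[vu pu] us']].
  rewrite mem_enum !inE => /andP[px sx ->]; rewrite dv px; split=> //.
  apply: (h2 _ (dv x) px); rewrite -share_edge_enc; [by rewrite ev|exact: in_region_side ht|exact: in_region_side (dv x)].
exists (Sub (enc u) (in_region_enc hlam vu)); last by rewrite /= dK.
rewrite mem_enum !inE /= dK // pu /= share_edge_enc ?h1 //; [exact: in_region_side ht|exact: in_region_side vu].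
Qed.

End CodeMatching.

Lemma contract_coord0 r f X : (forall j, (j < size X)%N -> nth (fun=> 0) X j r = 0) ->
  contract r f X = 0.
Proof.
elim: X f => //= x X IH f h; have h0 : x r = 0 := h 0%N isT.
rewrite h0 mul0r IH ?subr0 // => j hj; exact: (h j.+1).
Qed.

Lemma wdetS_cons n x X : (forall j, (j < size X)%N -> nth (fun=> 0) X j n = 0) ->
  wdet n.+1 (x :: X) = x n * wdet n X.
Proof. by move=> h /=; rewrite contract_coord0 ?subr0. Qed.

Lemma filter_ltnS l n : sorted ltn l -> [seq x <- l | (x < n.+1)%N] =
  if n \in l then rcons [seq x <- l | (x < n)%N] n else [seq x <- l | (x < n)%N].
Proof.
elim: l => //= x l IH hs; have hl := path_sorted hs.
have ha : all (fun y => (x < y)%N) l by move: hs; rewrite path_sortedE; [case/andP|exact: ltn_trans].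
rewrite inE IH //; case: (ltngtP x n) => hx.
- by rewrite ltnS (ltnW hx) /=; case: ifP.
- rewrite ltnS leqNgt hx /=.
  by case: ifP => // hn; have := allP ha n hn; lia.
- rewrite ltnS hx leqnn /=; have -> : n \in l = false.
    by apply/negP => hn; have := allP ha n hn; lia.
  by rewrite (_ : [seq _ <- l | _] = [::]) //; apply/eqP; rewrite -[_ == _]negbK -has_filter;
     apply/hasPn => y hy; have := allP ha y hy; lia.
Qed.

Lemma filter_ltn0 l n : all (fun c => n <= c)%N l -> [seq x <- l | (x < n)%N] = [::].
Proof.
by move=> h; apply/eqP; rewrite -[_ == _]negbK -has_filter; apply/hasPn => y hy; have := allP h y hy; lia.
Qed.

Ltac flia := repeat match goal with
  | H : forall _, _ |- _ => clear H
  | H : is_true (word _ _ _) |- _ => clear H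
  | H : is_true (is_strict_partition _) |- _ => clear H
  | H : is_true (in_region _ _ _) |- _ => clear H
  | H : @eq (GRing.Nmodule.sort _) _ _ |- _ => clear H
  | H : @eq bool (_ && _) _ |- _ => clear H
  end; lia.

(** * Crossing one column: from the letters of line [d + 1] to those of line [d] *)

Section Column.
Variables (m : nat) (lam : seq nat).
Hypothesis hlam : is_strict_partition lam.
Variables (s : bool) (d : nat) (rest : pred code).
Hypothesis hd : (0 < d <= part lam 1)%N.
Hypothesis hrest : forall s' i d' c, rest (s', i, d', c) -> (s' != s) && (0 < d')%N.

Local Notation k := (size lam).
Local Notation N := (m + k)%N.
Local Notation K' := (parts_ge lam d.+1).
Local Notation K := (parts_ge lam d).
Local Notation b := (k - K')%N.
Local Notation l0 := (k - K)%N.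
Local Notation subregion_gf := (subregion_gf m lam).

(** One such factor per path clears the half weights, which occur on the right only. *)
Definition side_factor (s : bool) : rat := if s then 2 else 1.

(** The weight of the lozenges crossing line [d] in the rows [W]; a line has at most one special
    row. *)
Definition line_weight (s : bool) (d : nat) (W : seq nat) : rat :=
  if s && has (special lam d) W then 1 / 2 else 1.

(** What is left of a side from column [d] outwards, once lozenges crossing line [d] have taken the
    inner triangles in the rows [W]. *)
Definition outer_cols (s : bool) (d : nat) (W : seq nat) : pred code := fun x =>
  let: (s', i, d', c) := x in
  (s' == s) && ((d < d')%N || (d' == d) && (~~ i || (c \notin W))).

Variables (u v : nat -> letter).
Hypothesis u_coord : forall c i, (K' <= i)%N -> u c i = 0.
Hypothesis u_low : forall c i, (c < b)%N -> u c i = 0.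
Hypothesis vE : forall c i, v c i =
  if (i < K')%N then \sum_(j < c.+1) u j i
  else if (i < K)%N then (if (c < l0)%N then 0 else if c == l0 then 1 else side_factor s) else 0.

Hypothesis hout : forall W, word b N W -> (d < part lam 1)%N || nilp W ->
  side_factor s ^+ K' * line_weight s d.+1 W * subregion_gf (predU rest (outer_cols s d.+1 W)) =
  wdet K' (map u W) * subregion_gf rest.

Variable l : seq nat.
Hypothesis hl : word l0 N l.

(** Column [d] has been cleared from the top down to row [n], and [W] collects the rows where line
    [d + 1] was crossed. State 0 has [j = n]; state 1 has [j = n - 1]. *)
Let stp (n j : nat) (W : seq nat) : pred code := fun x =>
  let: (s', i, d', c) := x in
  rest x || (s' == s) && [|| (d.+1 < d')%N, (d' == d.+1) && (~~ i || (c \notin W))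
    | (d' == d) && (if i then (c < j)%N && (c \notin l) else (c < n)%N)].

Let a (n : nat) : letter := fun i =>
  if (i < K')%N then \sum_(j < n) u j i else if (i < K)%N then side_factor s else 0.

Let cl : rat := side_factor s ^+ (K - K') * line_weight s d l.

Let G0 n W := side_factor s ^+ K' * line_weight s d.+1 W * subregion_gf (stp n n W).
Let G1 n W := if [&& 0 < n, n.-1 \notin l & l0 <= n.-1]%N then
  side_factor s ^+ K' * line_weight s d.+1 W * subregion_gf (stp n n.-1 W) else 0.

Let hKK : (K' <= K)%N. Proof. exact: parts_ge_anti. Qed.
Let hKS : (K <= K'.+1)%N. Proof. exact: parts_ge_step. Qed.
Let hKk : (K <= k)%N. Proof. exact: parts_ge_size. Qed.

(** The inner triangle of row [n] is gone, so the outer one either crosses line [d + 1] or takes the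
    inner triangle of row [n - 1], which leads to state 1. The outermost column has no line [d + 1]
    to cross. *)
Let pull n W : (b <= n < N)%N -> word n.+1 N W -> (d < part lam 1)%N || nilp W ->
  side_factor s ^+ K' * line_weight s d.+1 W * subregion_gf (stp n.+1 n W) =
  (if (d < part lam 1)%N then G0 n (n :: W) else 0) + G1 n W.
Proof.
move=> /andP[hbn hn] hW hdW.
have nW : n \notin W.
  by apply/negP => h; have /andP[_ /allP/(_ n h)] := hW; lia.
pose t : code := (s, false, d, n); pose u1 : code := (s, true, d.+1, n).
pose u2 : code := (s, true, d, n.-1).
have vt : in_region m lam t by rewrite /in_region /=; flia.
have pt : stp n.+1 n W t by rewrite /stp /=; flia.
have nrest i d' c : rest (s, i, d', c) = false by apply/negP => /hrest; rewrite eqxx.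
have pu1 : in_region m lam u1 && stp n.+1 n W u1 = (d < part lam 1)%N.
  rewrite /in_region /stp /= nW; case: (s); flia.
have e1 : side_factor s ^+ K' * line_weight s d.+1 W * (if in_region m lam u1 && stp n.+1 n W u1 then
    wgt lam t u1 * subregion_gf (fun x => [&& stp n.+1 n W x, x != t & x != u1]) else 0) =
    (if (d < part lam 1)%N then G0 n (n :: W) else 0).
  rewrite pu1; case: ifP => _; last by rewrite mulr0.
  rewrite /G0 wgt_outer // mulrA; congr (_ * _); last first.
    apply: subregion_gf_ext => // -[[[s' i] d'] c] _; rewrite /stp /t /u1 !xpair_eqE inE.
    case: (boolP (rest _)) => [/hrest|_] /=; case: (s' == s) => //=; case: i => //=; flia.
  rewrite -mulrA; congr (_ * _); rewrite /line_weight; case: (s) => //=.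
  case: (boolP (special lam d.+1 n)) => /= [hsp|_]; last by rewrite mulr1.
  have -> : has (special lam d.+1) W = false.
    apply/negP => /hasP[c hc /andP[_ /eqP e]]; move: hsp => /andP[_ /eqP e'].
    by move: nW; rewrite e' -e hc.
  by rewrite mul1r.
have e2 : (0 < n)%N -> side_factor s ^+ K' * line_weight s d.+1 W * (if in_region m lam u2 && stp n.+1 n W u2 then
    wgt lam t u2 * subregion_gf (fun x => [&& stp n.+1 n W x, x != t & x != u2]) else 0) = G1 n W.
  move=> n0; rewrite /G1; have -> : in_region m lam u2 && stp n.+1 n W u2 =
    [&& 0 < n, n.-1 \notin l & l0 <= n.-1]%N.
    by rewrite /in_region /stp /= nrest eqxx /=; case: (n.-1 \in l); case: (s) => /=; flia.
  case: ifP => // _; last by rewrite mulr0.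
  rewrite wgtC wgt_same mul1r; congr (_ * _).
  apply: subregion_gf_ext => // -[[[s' i] d'] c] _; rewrite /stp /t /u2 !xpair_eqE.
  case: (boolP (rest _)) => [/hrest|_] /=; case: (s' == s) => //=; case: i => //=; flia.
have [n0|n0] := posnP n.
  rewrite (@subregion_gf_rec m lam hlam _ t [:: u1]) //; first last.
  - move=> [[[s' i] d'] c] _ pu; rewrite /adjc /t inE /u1 !xpair_eqE.
    case: i pu => //= pu /andP[/eqP e]; subst s'; move: pu; rewrite nrest eqxx /=; flia.
  - by move=> x; rewrite inE => /eqP -> _; rewrite /adjc /= !eqxx /=; flia.
  by rewrite big_seq1 e1 /G1 n0 /= addr0.
rewrite (@subregion_gf_rec m lam hlam _ t [:: u1; u2]) //; first last.
- move=> [[[s' i] d'] c] _ pu; rewrite /adjc /t !inE /u1 /u2 !xpair_eqE.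
  case: i pu => //= pu /andP[/eqP e]; subst s'; move: pu; rewrite nrest eqxx /=; flia.
- by move=> x; rewrite !inE => /orP[] /eqP -> _; rewrite /adjc /= !eqxx /=; flia.
- by rewrite /= inE /u1 /u2 !xpair_eqE; flia.
by rewrite big_cons big_seq1 mulrDr e1 e2.
Qed.

Let nrest i d' c : rest (s, i, d', c) = false.
Proof. by apply/negP => /hrest; rewrite eqxx. Qed.

Let G0_in n W : (b <= n < N)%N -> word n.+1 N W -> (d < part lam 1)%N || nilp W -> n \in l ->
  G0 n.+1 W = (if (d < part lam 1)%N then G0 n (n :: W) else 0) + G1 n W.
Proof.
move=> hn hW hdW nl; rewrite -pull // /G0; congr (_ * _).
apply: subregion_gf_ext => // -[[[s' i] d'] c] _; rewrite /stp.
have [->|hc] := eqVneq c n; first by rewrite nl ltnn ltnSn !andbF.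
by case: (rest _) => //=; case: (s' == s) => //=; case: i => //=; flia.
Qed.

(** The inner triangle of row [n] must take the outer one of its own row, that of row [n + 1] having
    been removed. *)
Let G0_notin n W : (b <= n < N)%N -> n \notin l -> G0 n.+1 W = G0 n W.
Proof.
move=> /andP[hbn hn] nl; rewrite /G0; congr (_ * _).
pose t : code := (s, true, d, n); pose u1 : code := (s, false, d, n).
have vt : in_region m lam t by rewrite /in_region /=; case: (s); flia.
rewrite (@subregion_gf_rec m lam hlam _ t [:: u1]) //; first last.
- move=> [[[s' i] d'] c] _ pu; rewrite /adjc /t inE /u1 !xpair_eqE.
  case: i pu => /= pu.
    case: (boolP (rest (s', true, d', c))) => [/hrest|hr] h.
      by case: (s) h => /=; flia.
    by move: pu; rewrite (negbTE hr) /=; case: (s) h; case: (s') => //=; flia.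
  case/andP => /eqP e; subst s'; move: pu; rewrite nrest eqxx /=; flia.
- by move=> x; rewrite inE => /eqP -> _; rewrite /adjc /= !eqxx /=; flia.
- by rewrite /stp /= nl; flia.
rewrite big_seq1 wgt_same mul1r ifT; last first.
  by rewrite /in_region /stp /= nrest; case: (s); flia.
apply: subregion_gf_ext => // -[[[s' i] d'] c] _; rewrite /stp /t /u1 !xpair_eqE.
case: (boolP (rest _)) => [/hrest|_] /=; case: (s' == s) => //=; case: i => //=; flia.
Qed.

Let G1_notin n W : (b <= n < N)%N -> word n.+1 N W -> (d < part lam 1)%N || nilp W ->
  n \notin l ->
  G1 n.+1 W = (if (d < part lam 1)%N then G0 n (n :: W) else 0) + G1 n W.
Proof. by move=> hn hW hdW nl; rewrite -pull // {1}/G1 /= nl ifT //; flia. Qed.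

Let G1_in n W : n \in l -> G1 n.+1 W = 0.
Proof. by move=> nl; rewrite /G1 /= nl. Qed.

Let uu W : forall j, (j < size (map u W))%N -> nth (fun=> 0) (map u W) j K' = 0.
Proof.
move=> j; rewrite size_map => hj; rewrite (nth_map 0%N) //; exact: u_coord.
Qed.

(** At [n = b] no outer triangle of column [d] is left. If [K = K'], no inner one is left either. If
    [K = K' + 1], there is one more inner triangle, in row [b - 1]: it belongs to [l], or it was
    taken from above and the state is 1. *)
Let base W : word b N W -> (d < part lam 1)%N || nilp W ->
  cl * G0 b W = wdet K (map v [seq x <- l | (x < b)%N] ++ map u W) * subregion_gf rest /\
  cl * G1 b W = wdet K (map v [seq x <- l | (x < b)%N] ++ a b :: map u W) * subregion_gf rest.
Proof.
move=> hW hdW; have h := hout hW hdW; have /andP[hls hla] := hl.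
have stpE j : (j <= l0)%N || (j <= b)%N && (b.-1 \in l) || (K' == K) && (j == b) ->
    subregion_gf (stp b j W) = subregion_gf (predU rest (outer_cols s d.+1 W)).
  move=> hj; apply: subregion_gf_ext => // -[[[s' i] d'] c] /and4P[h1 h2 h3 h4].
  rewrite /stp /outer_cols /=; case: (rest _) => //=; case: (s' == s) => //=.
  have [ed|nd] := eqVneq d' d; last by rewrite orbF; case: ltngtP.
  subst d'; case: i h1 => /= h1; last by flia.
  have [e|hcb] := eqVneq c b.-1; last by flia.
  by subst c; case: (b.-1 \in l) hj => /=; flia.
have ua i : \sum_(j < b) u j i = 0 by apply: big1 => j _; apply: u_low.
have [eK|nK] := eqVneq K' K.
  rewrite filter_ltn0 /=; last by apply: sub_all hla => c; flia.
  have -> : cl = 1.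
    rewrite /cl eK subnn mul1r /line_weight ifF //; apply/negP => /andP[_ /hasP[c _ /andP[]]].
    by rewrite eK ltnn.
  rewrite !mul1r -eK; split; first by rewrite -h /G0 stpE // -?eK ?leqnn ?eqxx ?orbT.
  rewrite /G1 ifF; last by rewrite eK; flia.
  rewrite (@multilinear0 _ [::]) ?mul0r //; first exact: multilinear_wdet.
  by move=> i; rewrite /a -eK ua; case: (i < K')%N.
have eK : K = K'.+1 by flia.
have b0 : (0 < b)%N by flia.
have el : l0 = b.-1 by flia.
have hK1 : (K - K' = 1)%N by flia.
have fE : [seq x <- l | (x < b)%N] = if b.-1 \in l then [:: b.-1] else [::].
  rewrite -{1}(prednK b0) filter_ltnS // (@filter_ltn0 l b.-1) //.
  by apply: sub_all hla => c; flia.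
have vb i : v b.-1 i = (if i == K' then 1 else 0).
  rewrite vE el ltnn eqxx prednK // ua eK ltnS.
  by case: (ltngtP i K').
have ab i : a b i = (if i == K' then side_factor s else 0).
  by rewrite /a ua eK ltnS; case: (ltngtP i K').
have lK : special lam d b.-1 by rewrite /special el eqxx andbT; flia.
rewrite fE; case: ifP => hb.
  (* The factor of the new path cancels the half weight of its lowest row. *)
  have -> : cl = 1.
    rewrite /cl hK1 /line_weight /side_factor; have -> : has (special lam d) l by apply/hasP; exists b.-1.
    by case: (s).
  rewrite !mul1r eK; split.
    rewrite (@wdetS_cons K' (v b.-1) (map u W)); last exact: uu.
    by rewrite vb eqxx mul1r -h /G0 stpE // hb leqnn orbT.
  rewrite /G1 hb /= andbF; apply/esym/eqP; rewrite mulf_eq0; apply/orP; left; apply/eqP.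
  have ha := @alternating_wdet K'.+1; have hM := @multilinear_wdet K'.+1.
  have z : wdet K'.+1 (v b.-1 :: v b.-1 :: map u W) = 0.
    exact: (@alternating_eq0 _ [::] _ [::]).
  change (wdet K'.+1 ([:: v b.-1] ++ a b :: map u W) = 0).
  (* On the right [a b] is twice the letter [v b.-1], which additivity handles as a sum; either way
     the minor has two proportional columns. *)
  case: (s) ab => ab.
    rewrite (hM _ (v b.-1) (v b.-1)) ?z ?addr0 // => i.
    by rewrite ab vb; case: ifP => _; rewrite ?addr0.
  by rewrite (@multilinear_eq _ _ _ (v b.-1)) // => i; rewrite ab vb.
have clE : cl = side_factor s.
  rewrite /cl hK1 /line_weight ifF ?mulr1 //; apply/negP => /andP[_ /hasP[c hc /andP[_ /eqP e]]].
  by move: hc; rewrite e el hb.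
rewrite clE eK /=; split.
  rewrite contract_coord0 ?mul0r; last exact: uu.
  (* The inner triangle of row [b - 1] has no partner left, so state 0 is impossible. *)
  rewrite /G0; have -> : subregion_gf (stp b b W) = 0; last by rewrite !mulr0.
  rewrite (@subregion_gf_rec m lam hlam _ (s, true, d, b.-1) [::]) ?big_nil //.
  - by rewrite /in_region /=; case: (s); flia.
  - by rewrite /stp /= hb; flia.
  move=> [[[s' i] d'] c] hv pu; rewrite /adjc in_nil.
  case: i pu hv => /= pu hv.
    case: (boolP (rest (s', true, d', c))) => [/hrest|hr] h'.
      by case: (s) h' => /=; flia.
    by move: pu; rewrite (negbTE hr) /=; case: (s) h'; case: (s') => //=; flia.
  case/andP => /eqP e; subst s'; move: pu hv; rewrite nrest eqxx /in_region /=.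
  by have [ed|nd] := eqVneq d' d; [subst d'|]; flia.
have -> : G1 b W = side_factor s ^+ K' * line_weight s d.+1 W * subregion_gf (stp b b.-1 W).
  by rewrite /G1 ifT // hb; flia.
rewrite stpE; last by rewrite el leqnn.
by rewrite h contract_coord0 ?subr0; [rewrite ab eqxx mulrA | exact: uu].
Qed.

(* In state 1 the rows below [n] contain one outer element more than inner ones, and
   the sum over its position is the running sum [a n] of the outer letters. *)
Let claim n W : (b <= n <= N)%N -> word n N W -> (d < part lam 1)%N || nilp W ->
  cl * G0 n W = wdet K (map v [seq x <- l | (x < n)%N] ++ map u W) * subregion_gf rest /\
  cl * G1 n W = wdet K (map v [seq x <- l | (x < n)%N] ++ a n :: map u W) * subregion_gf rest.
Proof.
elim: n W => [|n IH] W /andP[hbn hn] hW hdW.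
  have e : b = 0%N by flia.
  by have := @base W; rewrite e; apply.
have [e|ne] := eqVneq b n.+1; first by rewrite -e; apply: base; rewrite // e.
have hbn' : (b <= n < N)%N by flia.
have hW' := word_weaken (leqnSn n) hW; have hW1 := word_cons hn hW.
have /andP[hls _] := hl.
have [IH0 IH1] := IH W ltac:(flia) hW' hdW.
have ha := @alternating_wdet K; have hM := @multilinear_wdet K.
set fl := map v [seq x <- l | (x < n)%N] in IH0 IH1 *.
have aS i : a n.+1 i = u n i + a n i.
  rewrite /a; case: ifP => h; first by rewrite big_ord_recr /= addrC.
  by rewrite u_coord ?add0r //; flia.
have pullE : cl * ((if (d < part lam 1)%N then G0 n (n :: W) else 0) + G1 n W) =
    wdet K (fl ++ a n.+1 :: map u W) * subregion_gf rest.
  rewrite (hM _ (u n) (a n)) // mulrDr mulrDl IH1; congr (_ + _).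
  case: ifP => hd1.
    have hdn : (d < part lam 1)%N || nilp (n :: W) by rewrite hd1.
    by have [-> _] := IH (n :: W) ltac:(flia) hW1 hdn.
  rewrite mulr0 multilinear0 ?mul0r // => i.
  by apply: u_coord; rewrite parts_ge_max //; flia.
have va i : v n i = a n.+1 i.
  rewrite vE /a; case: ifP => // h1; case: ifP => // h2; rewrite !ifF //; flia.
rewrite filter_ltnS //; case: ifP => nl.
  rewrite map_rcons cat_rcons -/fl G0_in // pullE cat_rcons G1_in // mulr0; split.
    by rewrite (@multilinear_eq _ fl (v n) (a n.+1)).
  rewrite (@multilinear_eq _ fl (v n) (a n.+1)) //.
  (* For [n] in [l] state 1 does not occur, and accordingly the column [a n.+1] appears twice. *)
  by rewrite (@alternating_eq0 _ fl _ [::]) // mul0r.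
rewrite -/fl G0_notin ?nl // G1_notin ?nl //.
Qed.

Lemma side_column :
  side_factor s ^+ K * line_weight s d l * subregion_gf (predU rest (outer_cols s d l)) = wdet K (map v l) * subregion_gf rest.
Proof.
have hbN : (b <= N <= N)%N by lia.
have [+ _] := @claim N [::] hbN isT (orbT _).
have -> : [seq x <- l | (x < N)%N] = l.
  by apply/all_filterP; have /andP[_] := hl; apply: sub_all => c; lia.
rewrite cats0 => <-; rewrite /cl /G0 /line_weight /= andbF mulr1.
have -> : subregion_gf (predU rest (outer_cols s d l)) = subregion_gf (stp N N [::]).
  apply: subregion_gf_ext => // -[[[s' i] d'] c] /and4P[h1 h2 h3 h4]; rewrite /stp /outer_cols /=.
  by case: (rest _) => //=; case: (s' == s) => //=; case: i h1 => /=; flia.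
by rewrite -{1}(subnK hKK) exprD; ring.
Qed.

End Column.

(* Index [e] stands for the vertical line at distance [part lam 1 + 1 - e] from
   the centre; coordinate [i] counts paths starting in the lower row [i + 1]. *)
Fixpoint line_letter (lam : seq nat) (s : bool) (e : nat) : nat -> letter := fun c i =>
  if e is e'.+1 then
    let d := (part lam 1 - e')%N in
    if (i < parts_ge lam d.+1)%N then \sum_(j < c.+1) line_letter lam s e' j i
    else if (i < parts_ge lam d)%N then
      (if (c < size lam - parts_ge lam d)%N then 0
       else if c == (size lam - parts_ge lam d)%N then 1 else side_factor s)
    else 0
  else 0.

Lemma line_letter_coord lam s e c i : (e <= part lam 1)%N ->
  (parts_ge lam ((part lam 1).+1 - e) <= i)%N -> line_letter lam s e c i = 0.
Proof.
case: e => // e he hi; rewrite /= subSS in hi *.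
have := @parts_ge_anti lam (part lam 1 - e) (part lam 1 - e).+1 (leqnSn _).
by move=> h; rewrite !ifF //; lia.
Qed.

Lemma line_letter_low lam s e c i : (e <= part lam 1)%N ->
  (c < size lam - parts_ge lam ((part lam 1).+1 - e))%N -> line_letter lam s e c i = 0.
Proof.
elim: e c i => // e IH c i he hc; rewrite /= subSS in hc *.
have h := @parts_ge_anti lam (part lam 1 - e) (part lam 1 - e).+1 (leqnSn _).
case: ifP => _; last by rewrite hc; case: ifP.
apply: big1 => -[j hj] _ /=; apply: IH; first by lia.
have -> : ((part lam 1).+1 - e = (part lam 1 - e).+1)%N by lia.
lia.
Qed.

Lemma sum_prevl (v : nat -> letter) i n :
  \sum_(j < n.+1) prevl v j i = \sum_(j < n) v j i.
Proof. by rewrite big_ord_recl /= add0r. Qed.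

(** A new path has coordinates 0, ..., 0, 1, 1, ... on the left. On the right, the half weight at
    its lowest row and the factor 2 make them 0, ..., 0, 1, 2, 2, ..., the left sequence plus its
    shift. Running sums commute with the shift, so the relation persists towards the centre. *)
Lemma line_letter_double lam e c i :
  line_letter lam true e c i = line_letter lam false e c i + prevl (line_letter lam false e) c i.
Proof.
elim: e c i => [|e IH] c i /=.
  by case: c => [|c] /=; rewrite ?addr0.
set d := (part lam 1 - e)%N; case: ifP => hi.
  under eq_bigr => j _ do rewrite IH.
  rewrite big_split /= sum_prevl; congr (_ + _).
  by case: c => [|c] /=; rewrite ?big_ord0 //= -/d hi.
case: c => [|c] /=; first by rewrite addr0; case: (size lam - parts_ge lam d)%N.
rewrite -/d hi; case: ifP => // _.
case: (ltngtP c.+1 (size lam - parts_ge lam d)) => h.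
- by rewrite addr0.
- by case: ifP.
- by rewrite addr0.
Qed.

(** * Both halves and the central column *)

Section Tilings.
Variables (m : nat) (lam : seq nat).
Hypothesis hlam : is_strict_partition lam.
Local Notation k := (size lam).
Local Notation N := (m + k)%N.
Local Notation L1 := (part lam 1).
Local Notation subregion_gf := (subregion_gf m lam).

(** Induction from the outermost line inwards. The case [e = 0] is a line just beyond the region,
    crossed by nothing. *)
Lemma side_matching s e (rest : pred code) :
  (forall s' i d' c, rest (s', i, d', c) -> (s' != s) && (0 < d')%N) ->
  (e <= L1)%N -> let d := (L1.+1 - e)%N in
  forall W, word (k - parts_ge lam d) N W -> (0 < e)%N || nilp W ->
  side_factor s ^+ parts_ge lam d * line_weight lam s d W * subregion_gf (predU rest (outer_cols s d W)) =
  wdet (parts_ge lam d) (map (line_letter lam s e) W) * subregion_gf rest.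
Proof.
move=> hr; elim: e => [|e IH] he d W hW hW0.
  case: W hW hW0 => // _ _; rewrite /d subn0 parts_ge_max // expr0 /line_weight andbF /= !mul1r.
  apply: subregion_gf_ext => // -[[[s' i] d'] c] /and4P[_ _ h _]; rewrite /= /outer_cols.
  by case: (rest _) => //=; case: (s' == s) => //=; lia.
have hd : d = (L1 - e)%N by rewrite /d subSS.
have hd1 : ((L1 - e).+1 = L1.+1 - e)%N by lia.
rewrite hd in hW *; apply: (@side_column m lam hlam s (L1 - e) rest _ hr (line_letter lam s e)) => //.
- by lia.
- by move=> c i; rewrite hd1; apply: line_letter_coord; lia.
- by move=> c i; rewrite hd1; apply: line_letter_low; lia.
- move=> W' hW' hd'; rewrite hd1; apply: IH; rewrite -?hd1 //; first by lia.
  by case/orP: hd' => [hd'|->]; rewrite ?orbT //; apply/orP; left; lia.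
Qed.

(** The analogue of [stp] for the central column, with both halves attached; [X] and [Y] are the
    rows crossed so far on its right and left. *)
Let cen (n j : nat) (X Y : seq nat) : pred code := fun x =>
  let: (s, i, d, c) := x in
  if s && (d == 0%N) then (if i then (c < j)%N else (c < n)%N)
  else if s then outer_cols true 1 X x else outer_cols false 1 Y x.

Let E0 n X Y := 2 ^+ k * line_weight lam true 1 X * subregion_gf (cen n n X Y).
Let E1 n X Y := if (0 < n)%N then 2 ^+ k * line_weight lam true 1 X * subregion_gf (cen n n.-1 X Y) else 0.

Let word_notin n W : word n.+1 N W -> n \notin W.
Proof. by move=> /andP[_ /allP h]; apply/negP => /h; lia. Qed.

Let pull_center n X Y : (n < N)%N -> word n.+1 N X ->
  2 ^+ k * line_weight lam true 1 X * subregion_gf (cen n.+1 n X Y) =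
  (if (0 < L1)%N then E0 n (n :: X) Y else 0) + E1 n X Y.
Proof.
move=> hn hX; have nX := word_notin hX.
pose t : code := (true, false, 0%N, n); pose u1 : code := (true, true, 1%N, n).
pose u2 : code := (true, true, 0%N, n.-1).
have hk := parts_ge1 hlam; have hk0 := parts_ge0 lam.
have vt : in_region m lam t by rewrite /in_region /= hk; flia.
have pt : cen n.+1 n X Y t by rewrite /cen /=.
have pu1 : in_region m lam u1 && cen n.+1 n X Y u1 = (0 < L1)%N.
  by rewrite /in_region /cen /= nX hk; flia.
have e1 : 2 ^+ k * line_weight lam true 1 X * (if in_region m lam u1 && cen n.+1 n X Y u1 then
    wgt lam t u1 * subregion_gf (fun x => [&& cen n.+1 n X Y x, x != t & x != u1]) else 0) =
    (if (0 < L1)%N then E0 n (n :: X) Y else 0).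
  rewrite pu1; case: ifP => _; last by rewrite mulr0.
  rewrite /E0 wgt_outer // mulrA; congr (_ * _); last first.
    apply: subregion_gf_ext => // -[[[s i] d] c] _; rewrite /cen /outer_cols /t /u1 !xpair_eqE inE.
    by case: s => //=; case: d => [|d] //=; case: i => //=; flia.
  rewrite -mulrA; congr (_ * _); rewrite /line_weight /=.
  case: (boolP (special lam 1 n)) => /= [hsp|_]; last by rewrite mulr1.
  have -> : has (special lam 1) X = false.
    apply/negP => /hasP[c hc /andP[_ /eqP e]]; move: hsp => /andP[_ /eqP e'].
    by move: nX; rewrite e' -e hc.
  by rewrite mul1r.
have e2 : (0 < n)%N -> 2 ^+ k * line_weight lam true 1 X * (if in_region m lam u2 && cen n.+1 n X Y u2 then
    wgt lam t u2 * subregion_gf (fun x => [&& cen n.+1 n X Y x, x != t & x != u2]) else 0) = E1 n X Y.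
  move=> n0; rewrite /E1 n0; have -> : in_region m lam u2 && cen n.+1 n X Y u2.
    by rewrite /in_region /cen /= hk0; flia.
  rewrite wgtC wgt_same mul1r; congr (_ * _).
  apply: subregion_gf_ext => // -[[[s i] d] c] _; rewrite /cen /outer_cols /t /u2 !xpair_eqE.
  by case: s => //=; case: d => [|d] //=; case: i => //=; flia.
have [n0|n0] := posnP n.
  rewrite (@subregion_gf_rec m lam hlam _ t [:: u1]) //; first last.
  - move=> [[[s i] d] c] _ pu; rewrite /adjc /t inE /u1 !xpair_eqE.
    by case: s i d pu => -[] [|d] //=; flia.
  - by move=> x; rewrite inE => /eqP -> _; rewrite /adjc /= !eqxx.
  by rewrite big_seq1 e1 /E1 n0 /= addr0.
rewrite (@subregion_gf_rec m lam hlam _ t [:: u1; u2]) //; first last.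
- move=> [[[s i] d] c] _ pu; rewrite /adjc /t !inE /u1 /u2 !xpair_eqE.
  by case: s i d pu => -[] [|d] //=; flia.
- by move=> x; rewrite !inE => /orP[] /eqP -> _; rewrite /adjc /=; flia.
by rewrite big_cons big_seq1 mulrDr e1 e2.
Qed.

Let E0_step n X Y : (n < N)%N -> word n.+1 N X -> word n.+1 N Y ->
  E0 n.+1 X Y = E0 n X Y +
    (if (0 < L1)%N then E0 n (n :: X) (n :: Y) + E1 n X (n :: Y) else 0).
Proof.
move=> hn hX hY; have nY := word_notin hY.
pose t : code := (true, true, 0%N, n); pose u1 : code := (true, false, 0%N, n).
pose u2 : code := (false, true, 1%N, n).
have hk := parts_ge1 hlam; have hk0 := parts_ge0 lam.
have vt : in_region m lam t by rewrite /in_region /= hk0; flia.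
rewrite {1}/E0 (@subregion_gf_rec m lam hlam _ t [:: u1; u2]) //; first last.
- move=> [[[s i] d] c] _ pu; rewrite /adjc /t !inE /u1 /u2 !xpair_eqE.
  by case: s i d pu => -[] [|d] //=; flia.
- by move=> x; rewrite !inE => /orP[] /eqP -> _; rewrite /adjc /= ?eqxx.
- by rewrite /cen /=.
rewrite big_cons big_seq1 mulrDr; congr (_ + _).
  rewrite ifT; last by rewrite /in_region /cen /= hk; flia.
  rewrite wgt_same mul1r /E0; congr (_ * _).
  apply: subregion_gf_ext => // -[[[s i] d] c] _; rewrite /cen /outer_cols /t /u1 !xpair_eqE.
  by case: s => //=; case: d => [|d] //=; case: i => //=; flia.
have -> : in_region m lam u2 && cen n.+1 n.+1 X Y u2 = (0 < L1)%N.
  by rewrite /in_region /cen /= nY hk; flia.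
case: ifP => hL; last by rewrite mulr0.
have := pull_center (n :: Y) hn hX; rewrite hL => <-; rewrite wgt_center // mul1r; congr (_ * _).
apply: subregion_gf_ext => // -[[[s i] d] c] _; rewrite /cen /outer_cols /t /u2 !xpair_eqE inE.
by case: s => //=; case: d => [|d] //=; case: i => //=; flia.
Qed.

Let E1_step n X Y : (n < N)%N -> word n.+1 N X ->
  E1 n.+1 X Y = E1 n X Y + (if (0 < L1)%N then E0 n (n :: X) Y else 0).
Proof. by move=> hn hX; rewrite {1}/E1 /= pull_center // addrC. Qed.

(** With the central column used up, the halves are independent: the right one is evaluated with the
    left one as [rest], then the left one alone. *)
Let E_base X Y : word 0 N X -> word 0 N Y -> (0 < L1)%N || nilp X && nilp Y ->
  E0 0 X Y = wdet k (map (line_letter lam true L1) X) * wdet k (map (line_letter lam false L1) Y).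
Proof.
move=> hX hY hg; rewrite /E0.
have hk := parts_ge1 hlam; have d1 : (L1.+1 - L1 = 1)%N by lia.
have gX : (0 < L1)%N || nilp X by case: (0 < L1)%N hg => //= /andP[].
have gY : (0 < L1)%N || nilp Y by case: (0 < L1)%N hg => //= /andP[].
have -> : subregion_gf (cen 0 0 X Y) = subregion_gf (predU (outer_cols false 1 Y) (outer_cols true 1 X)).
  apply: subregion_gf_ext => // -[[[s i] d] c] _; rewrite /cen /outer_cols /=.
  by case: s => //=; case: d => [|d] //=; case: i => //=; flia.
have := @side_matching true L1 (outer_cols false 1 Y) _ (leqnn _) X; rewrite d1 hk subnn => -> //.
  congr (_ * _); have := @side_matching false L1 pred0 _ (leqnn _) Y.
  rewrite d1 hk subnn /line_weight /= expr1n !mul1r => h.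
  rewrite (@subregion_gf_ext m lam hlam (outer_cols false 1 Y) (predU pred0 (outer_cols false 1 Y))) // h //.
  by rewrite (@subregion_gf_pred0 m lam hlam pred0) // mulr1.
by move=> s' i d' c /andP[/eqP -> h]; rewrite /=; flia.
Qed.

Lemma tilings_square : 2 ^+ k * M_A m lam = colsum k (line_letter lam false L1) N [::] ^+ 2.
Proof.
(* For the empty partition there is nothing beside the centre, and [E0] would ignore a nonempty [X]
   or [Y] although the minors vanish there; hence the guard. *)
pose F0 n (X Y : seq nat) := if (0 < L1)%N || nilp X && nilp Y then E0 n X Y else 0.
pose F1 n (X Y : seq nat) := if (0 < L1)%N || nilp X && nilp Y then E1 n X Y else 0.
have k0 : (0 < L1)%N || (k == 0%N).
  by have [h|h] := posnP k; rewrite ?orbT // (part_pos hlam).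
rewrite -(@interlacing_scan k N (line_letter lam false L1) (line_letter lam true L1) F0 F1).
- rewrite /F0 /= orbT /E0 /line_weight /= mulr1; congr (_ * _); apply: subregion_gf_predT => //.
  move=> [[[s i] d] c] /and4P[h1 h2 h3 h4]; rewrite /cen /outer_cols.
  by case: s h4 => /= h4; case: d h1 h3 h4 => [|d] //=; case: i => //=; flia.
- by move=> n i; apply: line_letter_double.
- move=> X Y hX hY; rewrite /F0 /F1; case: ifP => hg; first by rewrite E_base // /E1.
  split=> //; move: hg k0; case: (0 < L1)%N => //= hg /eqP ->.
  by case: X hg {hX} => [|x X]; case: Y {hY} => [|y Y] //= _; rewrite ?mulr0 ?mul0r.
- move=> n X Y hn hX hY; rewrite /F0 /F1 E0_step // E1_step //.
  case: (0 < L1)%N => //=; rewrite ?andbF !addr0.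
  by case: (nilp X && nilp Y).
Qed.

End Tilings.

(** * Shifted plane partitions as chains of interlacing diagonals *)

Fixpoint interlaced (lo : nat) (l : seq nat) : seq (seq nat) :=
  if l is x :: l' then [seq r :: rs | r <- iota lo (x.+1 - lo), rs <- interlaced x.+1 l']
  else [:: [::]].

(* Cells (i, i + t) of diagonal [t] with entry [p] are recorded by the number
   [p + size lam - i]; this turns the weak inequalities between neighbouring
   diagonals [t], [t + 1], that is lines [d = t + 1] and [d + 1], into interlacing. *)
Definition next_words (lam : seq nat) (d : nat) (l : seq nat) : seq (seq nat) :=
  if parts_ge lam d.+1 == parts_ge lam d then interlaced (size lam - parts_ge lam d) l
  else if l is x :: l' then interlaced x.+1 l' else [::].

Lemma multilinear_sum f (u : nat -> letter) A B (s : seq nat) : multilinear f ->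
  f (A ++ (fun i => \sum_(j <- s) u j i) :: B) = \sum_(j <- s) f (A ++ u j :: B).
Proof.
move=> hf; elim: s => [|j s IH].
  by rewrite big_nil multilinear0 // => i; rewrite big_nil.
rewrite big_cons (hf A (u j) (fun i => \sum_(j <- s) u j i)) ?IH // => i.
by rewrite big_cons.
Qed.

(** Each column sums [u] over the block of rows from which an interlaced word may choose the
    corresponding entry. *)
Fixpoint dletters (u : nat -> letter) (lo : nat) (l : seq nat) : seq letter :=
  if l is x :: l' then (fun i => \sum_(j <- iota lo (x.+1 - lo)) u j i) :: dletters u x.+1 l'
  else [::].

Lemma sum_interlaced f u A lo l : multilinear f ->
  \sum_(r <- interlaced lo l) f (A ++ map u r) = f (A ++ dletters u lo l).
Proof.
move=> hf; elim: l lo A => [|x l IH] lo A /=; first by rewrite big_seq1.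
rewrite big_allpairs_dep /= multilinear_sum //; apply: eq_bigr => j _.
have := IH x.+1 (rcons A (u j)); rewrite cat_rcons => <-.
by apply: eq_bigr => r _; rewrite cat_rcons.
Qed.

(** Block sums are differences of consecutive running sums. With [a lo] in front, adding each column
    to the next telescopes them without changing [f]. *)
Lemma dletters_running f (u a : nat -> letter) A lo l : multilinear f -> alternating f ->
  (forall n i, (lo <= n)%N -> a n.+1 i = u n i + a n i) ->
  sorted ltn l -> all (leq lo) l ->
  f (A ++ a lo :: dletters u lo l) = f (A ++ a lo :: map (fun x => a x.+1) l).
Proof.
move=> hM hA; elim: l lo A => // x l IH lo A ha hs /andP[hx hl] /=.
have hS n : (lo <= n)%N -> forall i, a n i = (\sum_(j <- iota lo (n - lo)) u j i) + a lo i.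
  elim: n => [|n IHn] hn i.
    by have -> : lo = 0%N by [lia]; rewrite big_nil add0r.
  have [->|ne] := eqVneq lo n.+1; first by rewrite subnn big_nil add0r.
  rewrite ha ?IHn; [|lia|lia].
  have -> : (n.+1 - lo = (n - lo) + 1)%N by lia.
  rewrite iotaD big_cat big_seq1 /=; have -> : (lo + (n - lo) = n)%N by lia.
  ring.
have e B : f (A ++ a lo :: a x.+1 :: B) =
    f (A ++ a lo :: (fun i => \sum_(j <- iota lo (x.+1 - lo)) u j i) :: B).
  have := hM (rcons A (a lo)) (fun i => \sum_(j <- iota lo (x.+1 - lo)) u j i) (a lo) (a x.+1) B.
  rewrite !cat_rcons => ->; last by apply: hS; lia.
  by rewrite (@alternating_eq0 _ A _ [::]) // addr0.
have := IH x.+1 (rcons A (a lo)); rewrite !cat_rcons -e; apply.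
- by move=> n i hn; apply: ha; lia.
- exact: path_sorted hs.
by move: hs => /=; rewrite path_sortedE; [case/andP | exact: ltn_trans].
Qed.

Section Diagonals.
Variables (m : nat) (lam : seq nat).
Hypothesis hlam : is_strict_partition lam.
Local Notation k := (size lam).
Local Notation N := (m + k)%N.
Local Notation L1 := (part lam 1).

(** Column operations turn the running sums of line [d] into block sums, and additivity expands
    these over interlaced words. If a path starts at line [d], the leading column is expanded away,
    and with it the first entry of [l]. *)
Lemma wdet_next_words e l : (e < L1)%N -> word (k - parts_ge lam (L1 - e)) N l ->
  wdet (parts_ge lam (L1 - e)) (map (line_letter lam false e.+1) l) =
  \sum_(r <- next_words lam (L1 - e) l) wdet (parts_ge lam (L1.+1 - e)) (map (line_letter lam false e) r).
Proof.
move=> he hl; rewrite subSn ?(ltnW he) //; set d := (L1 - e)%N in hl *.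
set K := parts_ge lam d in hl *; set K' := parts_ge lam d.+1.
have hd1 : (d.+1 = L1.+1 - e)%N by rewrite /d; lia.
have hKK : (K' <= K)%N by apply: parts_ge_anti.
have hKS : (K <= K'.+1)%N by apply: parts_ge_step.
have hKk : (K <= k)%N by apply: parts_ge_size.
have /andP[hs ha] := hl.
pose a n : letter := fun i => if (i < K')%N then \sum_(j < n) line_letter lam false e j i
  else if (i < K)%N then 1 else 0.
have uc c i : (K' <= i)%N -> line_letter lam false e c i = 0.
  by move=> hi; apply: line_letter_coord; rewrite -?hd1 //; lia.
have ul c i : (c < k - K')%N -> line_letter lam false e c i = 0.
  by move=> hi; apply: line_letter_low; rewrite -?hd1 //; lia.
have aS n i : a n.+1 i = line_letter lam false e n i + a n i.
  rewrite /a; case: ifP => h; first by rewrite big_ord_recr /= addrC.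
  by rewrite uc ?add0r //; lia.
have va c : (k - K <= c)%N -> line_letter lam false e.+1 c =1 a c.+1.
  move=> hc i; rewrite /= -/d -/K -/K' /a; case: ifP => // _; case: ifP => // _.
  by rewrite ifF; [case: ifP | lia].
have vaE f A l' : multilinear f -> all (leq (k - K)) l' ->
    f (A ++ map (line_letter lam false e.+1) l') = f (A ++ map (fun x => a x.+1) l').
  move=> hf; elim: l' A => // x l' IH A /andP[hx hl']; rewrite map_cons.
  by rewrite (multilinear_eq _ _ hf (va x hx)) -cat_rcons IH // cat_rcons.
have hM n := @multilinear_wdet n; have hA n := @alternating_wdet n.
have hal : all (leq (k - K)) l by apply: sub_all ha => c; lia.
rewrite (vaE _ [::]) // /next_words -/d -/K -/K'.
case: eqP => eK.
  rewrite eK (@sum_interlaced _ _ [::]) //=; case: l hs hal {ha hl} => // x l hs /andP[hx hal] /=.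
  have hx' : all (leq x.+1) l by move: hs => /=; rewrite path_sortedE; [case/andP | exact: ltn_trans].
  rewrite -(@dletters_running _ (line_letter lam false e) a [::] x.+1) //; last exact: path_sorted hs.
  apply: (@multilinear_eq _ [::]) => // i; rewrite /a eK.
  case: ifP => hi; last first.
    by rewrite ?hi big1_seq // => j _; apply: uc; rewrite eK; lia.
  (* The letters vanish below row [k - K], so this running sum is already a block sum. *)
  rewrite -(big_mkord xpredT (fun j => line_letter lam false e j i)) /index_iota subn0.
  have -> : x.+1 = ((k - K) + (x.+1 - (k - K)))%N by lia.
  rewrite iotaD big_cat /= big1_seq ?add0r ?addKn //; last first.
    by move=> j; rewrite mem_iota => /= hj; apply: ul; rewrite eK; lia.
have eKS : K = K'.+1 by lia.
rewrite eKS; case: l hs hal {ha hl} => [|x l] hs hal; first by rewrite big_nil.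
have hx' : all (leq x.+1) l by move: hs => /=; rewrite path_sortedE; [case/andP | exact: ltn_trans].
rewrite map_cons -[_ :: _]cat0s.
rewrite -(@dletters_running _ (line_letter lam false e) a [::] x.+1) //; last exact: path_sorted hs.
rewrite (@sum_interlaced _ _ [::]) // !cat0s wdetS_cons.
  by rewrite /a ltnn eKS ltnSn mul1r.
elim: (l) (x.+1) => // y l' IH z [|j] hj /=; last exact: IH.
by rewrite big1_seq // => j _; apply: uc.
Qed.

End Diagonals.

Lemma mem_interlaced lo l r : reflect (size r = size l /\
   forall j, (j < size l)%N ->
     (if j is j'.+1 then (nth 0 l j').+1 else lo) <= nth 0 r j <= nth 0 l j)%N
  (r \in interlaced lo l).
Proof.
apply: (iffP idP).
  elim: l lo r => [|x l IH] lo r /=; first by rewrite inE => /eqP ->.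
  case/allpairsPdep => y [rs [+ hrs ->]]; rewrite mem_iota => hy.
  have [h1 h2] := IH _ _ hrs; split=> [|[|j] hj] /=; first by rewrite h1.
    by lia.
  by have := h2 j hj; case: j hj.
elim: l lo r => [|x l IH] lo r /= [hs h]; first by case: r hs {h}.
case: r hs h => // y rs [hs] h; apply/allpairsPdep; exists y, rs; split => //.
  by rewrite mem_iota; have := h 0%N isT; rewrite /=; lia.
apply: IH; split => // j hj; have := h j.+1 hj; case: j hj => //.
Qed.

Lemma uniq_interlaced lo l : uniq (interlaced lo l).
Proof.
elim: l lo => //= x l IH lo; apply: allpairs_uniq_dep; first exact: iota_uniq.
  by move=> y _; apply: IH.
by move=> [y rs] [y' rs'] _ _ [-> ->].
Qed.

Lemma word_tail lo N x l : word lo N (x :: l) -> (lo <= x < N)%N /\ word x.+1 N l.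
Proof.
rewrite /word /= => /and3P[hs hx ha]; split=> //; rewrite (path_sorted hs) /=.
move: hs; rewrite path_sortedE; last exact: ltn_trans.
case/andP => h _; apply/allP => c hc.
by have := allP h c hc; have := allP ha c hc => /=; lia.
Qed.

Lemma word_bounds lo N l j : word lo N l -> (j < size l)%N ->
  (lo + j <= nth 0 l j)%N /\ (nth 0 l j + (size l - j) <= N)%N.
Proof.
elim: l lo j => // x l IH lo j /word_tail[hx hw] hj.
case: j hj => [|j] hj /=; last by have := IH x.+1 j hw hj; lia.
case: l IH hw {hj} => [|y l] IH hw /=; first by lia.
by have /= := IH x.+1 0%N hw isT; lia.
Qed.

Section Rows.
Variables (m : nat) (lam : seq nat).
Hypothesis hlam : is_strict_partition lam.
Local Notation k := (size lam).
Local Notation N := (m + k)%N.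
Local Notation L1 := (part lam 1).

(** Positions are counted from the end of the words: [i] is then the row of the array, whether or
    not a row ends between the two diagonals. *)
Lemma mem_next_words d l r : size l = parts_ge lam d -> reflect (size r = parts_ge lam d.+1 /\
   forall i, (0 < i <= parts_ge lam d.+1)%N ->
     nth 0 r (parts_ge lam d.+1 - i) <= nth 0 l (parts_ge lam d - i) /\
     (if i < parts_ge lam d then nth 0 l (parts_ge lam d - i.+1) < nth 0 r (parts_ge lam d.+1 - i)
      else k - parts_ge lam d <= nth 0 r (parts_ge lam d.+1 - i)))%N
  (r \in next_words lam d l).
Proof.
set K := parts_ge lam d; set K' := parts_ge lam d.+1 => hl.
have hKK : (K' <= K)%N by apply: parts_ge_anti.
have hKS : (K <= K'.+1)%N by apply: parts_ge_step.
rewrite /next_words -/K -/K'; case: eqP => eK.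
  rewrite eK; apply: (iffP (mem_interlaced _ _ _)); rewrite hl => -[hs h]; split => // i hi.
    have := h (K - i)%N ltac:(lia); case: ifP => hiK.
      by have -> : (K - i = (K - i.+1).+1)%N by [lia]; move=> /andP[-> ->].
    by have -> : (K - i = 0)%N by [lia]; move=> /andP[-> ->].
  have := h (K - i)%N ltac:(lia); have -> : (K - (K - i) = i)%N by lia.
  case: i hi => [|i] hi; first by rewrite subn0 ltnn; lia.
  have -> : (K - i.+1 < K)%N by lia.
  have -> : (K - (K - i.+1).+1 = i)%N by lia.
  by lia.
have eKS : K = K'.+1 by lia.
case: l hl => [|x l] hl; first by move: hl => /=; lia.
have {}hl : size l = K' by move: hl => /=; lia.
apply: (iffP (mem_interlaced _ _ _)); rewrite hl => -[hs h]; split => // i hi.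
  have := h (K' - i)%N ltac:(lia); rewrite eKS ltnS ifT; last by lia.
  have -> : (K'.+1 - i = (K' - i).+1)%N by lia.
  have -> : (K'.+1 - i.+1 = K' - i)%N by lia.
  by case: (K' - i)%N => [|j] /andP[h1 h2]; split.
have := h (K' - i)%N ltac:(lia); have -> : (K' - (K' - i) = i)%N by lia.
have -> : (K - (K' - i) = i.+1)%N by lia.
have -> : (K - (K' - i).+1 = i)%N by lia.
have -> : (K' - i < K)%N by lia.
by case: i hi => [|i] hi [h1 h2]; apply/andP; split.
Qed.

Lemma uniq_next_words d l : uniq (next_words lam d l).
Proof. by rewrite /next_words; case: ifP => _; [|case: l => // x l]; apply: uniq_interlaced. Qed.

Fixpoint chains (e : nat) (l : seq nat) : seq (seq (seq nat)) :=
  if e is e'.+1 then [seq r :: ch | r <- next_words lam (L1 - e') l, ch <- chains e' r]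
  else if nilp l then [:: [::]] else [::].

Lemma uniq_chains e l : uniq (chains e l).
Proof.
elim: e l => [|e IH] l /=; first by case: nilp.
apply: allpairs_uniq_dep; first exact: uniq_next_words.
  by move=> r _; apply: IH.
by move=> [y rs] [y' rs'] _ _ [-> ->].
Qed.

Lemma chains_size e l ch : (e <= L1)%N -> ch \in chains e l -> size l = parts_ge lam (L1.+1 - e).
Proof.
elim: e l ch => [|e IH] l ch he /=.
  by rewrite subn0 parts_ge_max //; case: l.
case/allpairsPdep => r [ch' [hr hch _]]; have := IH _ _ (ltnW he) hch.
rewrite subSS subSn ?(ltnW he) //; move: hr; set d := (L1 - e)%N; rewrite /next_words.
have := parts_ge_step hlam d; have := @parts_ge_anti lam d d.+1 (leqnSn _).
case: eqP => [<-|ne] h1 h2.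
  by case/mem_interlaced => ->.
by case: l => // x l /mem_interlaced[-> _] /=; lia.
Qed.

Lemma mem_chains e l ch : (e <= L1)%N -> reflect
  [/\ size ch = e, nth [::] (l :: ch) e = [::] &
   forall t, (t < e)%N -> nth [::] (l :: ch) t.+1 \in
      next_words lam (L1.+1 - e + t) (nth [::] (l :: ch) t)]
  (ch \in chains e l).
Proof.
move=> he; apply: (iffP idP).
  elim: e l ch he => [|e IH] l ch he /=.
    by case: l => //; rewrite inE => /eqP ->.
  case/allpairsPdep => r [ch' [hr hch ->]] /=.
  have [h1 h2 h3] := IH _ _ (ltnW he) hch; split => //; first by rewrite h1.
  case=> [_|t ht] /=; first by rewrite subSS addn0.
  have := h3 t ht; rewrite /=; congr (_ \in next_words _ _ _); lia.
elim: e l ch he => [|e IH] l ch he /= [h1 h2 h3].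
  by rewrite h2; case: ch h1 {h3}.
case: ch h1 h2 h3 => // r ch [h1] h2 h3; apply/allpairsPdep; exists r, ch; split => //.
  by have := h3 0%N isT; rewrite /= subSS addn0.
apply: IH => //; first by lia.
split => // t ht; have := h3 t.+1 ht; rewrite /=; congr (_ \in next_words _ _ _); lia.
Qed.

Lemma next_words_word e l r : (e < L1)%N -> word (k - parts_ge lam (L1 - e)) N l ->
  r \in next_words lam (L1 - e) l -> word (k - parts_ge lam (L1.+1 - e)) N r.
Proof.
move=> he; rewrite subSn ?(ltnW he) //; set d := (L1 - e)%N.
have h1 := parts_ge_step hlam d; have h2 := @parts_ge_anti lam d d.+1 (leqnSn _).
have H lo l' r' : word lo N l' -> r' \in interlaced lo l' -> word lo N r'.
  elim: l' lo r' => [|x l' IH] lo r'; first by move=> _; rewrite inE => /eqP ->.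
  move=> hw /allpairsPdep[y [rs [+ hrs ->]]]; rewrite mem_iota => hy.
  have [hx hw'] := word_tail hw.
  apply: (@word_weaken lo y); first by lia.
  apply: word_cons; first by lia.
  by apply: word_weaken (IH _ _ hw' hrs); lia.
move=> hl; rewrite /next_words; case: eqP => [->|ne]; first exact: H.
case: l hl => // x l hw hr; have [hx hw'] := word_tail hw.
by apply: word_weaken (H _ _ _ hw' hr); lia.
Qed.

Lemma wdet_chains e l : (e <= L1)%N -> word (k - parts_ge lam (L1.+1 - e)) N l ->
  wdet (parts_ge lam (L1.+1 - e)) (map (line_letter lam false e) l) = (size (chains e l))%:R.
Proof.
elim: e l => [|e IH] l he hl.
  by rewrite subn0 parts_ge_max //; case: l hl.
rewrite subSS in hl *; rewrite (wdet_next_words hlam he hl) size_allpairs_dep sumnE big_map natr_sum.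
rewrite !big_seq; apply: eq_bigr => r hr; apply: IH; first exact: ltnW.
exact: next_words_word hl hr.
Qed.

Definition all_chains := [seq l :: ch | l <- increasing_words N, ch <- chains L1 l].

Lemma colsum_chains : colsum k (line_letter lam false L1) N [::] = (size all_chains)%:R.
Proof.
rewrite colsum_increasing_words size_allpairs_dep sumnE big_map natr_sum !big_seq.
apply: eq_bigr => l; rewrite mem_increasing_words cats0 => hl.
have := @wdet_chains L1 l (leqnn _); have -> : (L1.+1 - L1 = 1)%N by lia.
by rewrite parts_ge1 // subnn; apply.
Qed.

Lemma uniq_all_chains : uniq all_chains.
Proof.
apply: allpairs_uniq_dep; first exact: uniq_increasing_words.
  by move=> r _; apply: uniq_chains.
by move=> [y rs] [y' rs'] _ _ [-> ->].
Qed.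

End Rows.

(** * Counting shifted plane partitions *)

Definition pval (m : nat) (D : {fset cell}) (p : {ffun D -> 'I_m.+1}) (i j : nat) : nat :=
  if insub (i, j) is Some x then p x else 0%N.

Lemma pvalE m (D : {fset cell}) (p : {ffun D -> 'I_m.+1}) (x : D) :
  pval p (val x).1 (val x).2 = p x.
Proof. by rewrite /pval -surjective_pairing valK. Qed.

Lemma pval_le m (D : {fset cell}) (p : {ffun D -> 'I_m.+1}) i j : (pval p i j <= m)%N.
Proof. by rewrite /pval; case: insub => // x; rewrite -ltnS. Qed.

Lemma weakly_decreasingP m (D : {fset cell}) (p : {ffun D -> 'I_m.+1}) :
  reflect (forall i j i' j', (i, j) \in D -> (i', j') \in D ->
    (i' == i.+1) && (j' == j) || (i' == i) && (j' == j.+1) -> (pval p i' j' <= pval p i j)%N)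
  (weakly_decreasing p).
Proof.
apply: (iffP forallP) => [h i j i' j' hx hy hxy|h x].
  have /forallP/(_ (Sub (i', j') hy)) := h (Sub (i, j) hx).
  rewrite /= !xpair_eqE hxy implyTb.
  by rewrite -(pvalE p (Sub (i, j) hx)) -(pvalE p (Sub (i', j') hy)).
apply/forallP => y; apply/implyP; rewrite -!pvalE.
case: x y => -[i j] hx [[i' j'] hy] /=; rewrite !xpair_eqE; exact: h.
Qed.

Section CountSPP.
Variables (m : nat) (lam : seq nat).
Hypothesis hlam : is_strict_partition lam.
Local Notation k := (size lam).
Local Notation N := (m + k)%N.
Local Notation L1 := (part lam 1).
Local Notation D := (shifted_diagram lam).

Lemma mem_diag i t : ((i, i + t) \in D)%N = (0 < i <= parts_ge lam t.+1)%N.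
Proof.
rewrite mem_shifted; case: (posnP i) => [->|i0] //=.
case: (leqP i k) => hi /=; last by have := parts_ge_size lam t.+1; lia.
by rewrite leq_parts_ge //; lia.
Qed.

(** The rows are listed from the last to the first, which makes the word increasing for a weakly
    decreasing array. *)
Definition diag_word (p : {ffun D -> 'I_m.+1}) (t : nat) : seq nat :=
  mkseq (fun j => let i := (parts_ge lam t.+1 - j)%N in (pval p i (i + t) + (k - i))%N) (parts_ge lam t.+1).

(** The diagonal [t = L1] is empty; it supplies the empty word that ends a chain. *)
Definition diag_words p : seq (seq nat) := mkseq (diag_word p) L1.+1.

Lemma nth_diag_word p t i : (0 < i <= parts_ge lam t.+1)%N ->
  nth 0%N (diag_word p t) (parts_ge lam t.+1 - i) = (pval p i (i + t) + (k - i))%N.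
Proof.
by move=> hi; rewrite nth_mkseq /=; [have -> : (parts_ge lam t.+1 - (parts_ge lam t.+1 - i) = i)%N by lia|lia].
Qed.

Lemma diag_words_inj : injective diag_words.
Proof.
move=> p q e; apply/ffunP => x; apply: ord_inj; rewrite -!pvalE.
case: x => -[i j] hx /=; have := hx; rewrite mem_shifted => /and4P[h1 h2 h3 h4].
have et : (j = i + (j - i))%N by lia.
move: hx; rewrite et mem_diag => hi; set t := (j - i)%N in et hi *.
have hp := part_le1 hlam (i := i) ltac:(lia).
have : nth [::] (diag_words p) t = nth [::] (diag_words q) t by rewrite e.
rewrite !nth_mkseq; [|lia|lia] => ew.
have : nth 0%N (diag_word p t) (parts_ge lam t.+1 - i) = nth 0%N (diag_word q t) (parts_ge lam t.+1 - i).
  by rewrite ew.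
by rewrite !nth_diag_word //; apply: addIn.
Qed.

Lemma diag_word_next p t : weakly_decreasing p ->
  diag_word p t.+1 \in next_words lam t.+1 (diag_word p t).
Proof.
move=> hp; have hw := weakly_decreasingP _ hp; have hs := parts_ge_size lam t.+1.
have ha := @parts_ge_anti lam t.+1 t.+2 (leqnSn _).
apply/(mem_next_words hlam) => //; rewrite ?size_mkseq //; split => // i hi.
rewrite (@nth_diag_word p t.+1 i) // (@nth_diag_word p t i); last by lia.
split.
  by rewrite leq_add2r; apply: hw; rewrite ?mem_diag; lia.
case: ifP => hiK; last by lia.
rewrite nth_diag_word; last by lia.
have : (pval p i.+1 (i.+1 + t) <= pval p i (i + t.+1))%N.
  by apply: hw; rewrite ?mem_diag; lia.
lia.
Qed.

Lemma diag_words_mem p : weakly_decreasing p -> diag_words p \in all_chains m lam.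
Proof.
move=> hp; rewrite /diag_words /mkseq /= -[1%N]addn0 iotaDl -map_comp -/(mkseq _ _).
set ch := mkseq _ _.
have hn t : (t <= L1)%N -> nth [::] (diag_word p 0 :: ch) t = diag_word p t.
  by case: t => // t ht /=; rewrite nth_mkseq //= add1n.
have hm : ch \in chains lam L1 (diag_word p 0).
  apply/mem_chains => //; split; first by rewrite size_mkseq.
    by rewrite hn // /diag_word parts_ge_max.
  move=> t ht; rewrite !hn; [|lia|lia].
  by have -> : (L1.+1 - L1 + t = t.+1)%N by [lia]; apply: diag_word_next.
apply/allpairsPdep; exists (diag_word p 0), ch; split => //.
rewrite mem_increasing_words; apply/andP; split.
  apply/(sortedP 0%N) => j; rewrite size_mkseq => hj.
  have hs := parts_ge_step hlam 1.
  have /(@mem_next_words lam hlam _ _ _ (size_mkseq _ _))[_ h] := diag_word_next 0 hp.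
  have [h1 h2] := h (parts_ge lam 1 - j.+1)%N ltac:(lia).
  move: h2; rewrite ifT; last by lia.
  have e1 : j.+1 = (parts_ge lam 1 - (parts_ge lam 1 - j.+1))%N by lia.
  have e2 : j = (parts_ge lam 1 - (parts_ge lam 1 - j.+1).+1)%N by lia.
  by rewrite -e1 in h1; rewrite -e2 => h2; apply: leq_trans h2 h1.
apply/allP => c /mapP[j]; rewrite mem_iota => hj -> /=.
by have := pval_le p (parts_ge lam 1 - j) (parts_ge lam 1 - j + 0); have := parts_ge_size lam 1; lia.
Qed.

Lemma all_chains_diag c : c \in all_chains m lam ->
  exists2 p : {ffun D -> 'I_m.+1}, weakly_decreasing p & diag_words p = c.
Proof.
case/allpairsPdep => l [ch [hl hch ->]]; rewrite mem_increasing_words in hl.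
have hsl := chains_size hlam (leqnn _) hch.
have /(mem_chains hlam _ _ (leqnn _))[hs hlast hcomp] := hch.
set c' := l :: ch in hlast hcomp *.
have e1 : (L1.+1 - L1 = 1)%N by lia.
rewrite e1 in hsl hcomp.
have hsz t : (t <= L1)%N -> size (nth [::] c' t) = parts_ge lam t.+1.
  elim: t => [|t IH] ht; first by [].
  by have /(@mem_next_words lam hlam _ _ _ (IH (ltnW ht)))[] := hcomp t ht.
have hrow t : (t < L1)%N -> forall i, (0 < i <= parts_ge lam t.+2)%N ->
   (nth 0 (nth [::] c' t.+1) (parts_ge lam t.+2 - i) <= nth 0 (nth [::] c' t) (parts_ge lam t.+1 - i))%N /\
   (if i < parts_ge lam t.+1 then
      nth 0 (nth [::] c' t) (parts_ge lam t.+1 - i.+1) < nth 0 (nth [::] c' t.+1) (parts_ge lam t.+2 - i)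
    else k - parts_ge lam t.+1 <= nth 0 (nth [::] c' t.+1) (parts_ge lam t.+2 - i))%N.
  by move=> ht; have /(@mem_next_words lam hlam _ _ _ (hsz t (ltnW ht)))[] := hcomp t ht.
pose L t i := nth 0%N (nth [::] c' t) (parts_ge lam t.+1 - i).
(* These bounds put the entries between 0 and [m]. The upper one is inherited along the row, the
   lower one comes from row [i + 1] of the previous diagonal. *)
have hb t : (t <= L1)%N -> forall i, (0 < i <= parts_ge lam t.+1)%N -> (k - i <= L t i <= m + k - i)%N.
  elim: t => [|t IH] ht i hi.
    have hk := parts_ge1 hlam; rewrite hk in hi hsl.
    have := @word_bounds 0 N l (k - i)%N hl ltac:(lia).
    by rewrite /L /= hk hsl; lia.
  have hA := @parts_ge_anti lam t.+1 t.+2 (leqnSn _); have hS := parts_ge_size lam t.+1.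
  have [h1 h2] := hrow t ht i hi; have := IH (ltnW ht) i ltac:(lia).
  have := IH (ltnW ht) i.+1; move: h2; rewrite -/(L t i.+1) -/(L t.+1 i) in h1 *.
  rewrite -/(L t i) in h1 *; case: ifP => h3; lia.
pose p : {ffun D -> 'I_m.+1} := [ffun x : D =>
  inord (L ((val x).2 - (val x).1)%N (val x).1 - (k - (val x).1))].
have hpv i t : (0 < i <= parts_ge lam t.+1)%N -> pval p i (i + t) = (L t i - (k - i))%N.
  move=> hi; have hx : (i, i + t)%N \in D by rewrite mem_diag.
  have /= -> := pvalE p (Sub (i, i + t)%N hx); rewrite ffunE /= addKn inordK //.
  have ht : (t <= L1)%N.
    by rewrite leqNgt; apply/negP => h; have := parts_ge_max hlam (d := t.+1); lia.
  by have := hb t ht i hi; have := parts_ge_size lam t.+1; lia.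
have htD i t : (i, i + t)%N \in D -> (0 < i <= parts_ge lam t.+1)%N /\ (t < L1)%N.
  rewrite mem_diag => h; split => //.
  by rewrite ltnNge; apply/negP => h'; have := parts_ge_max hlam (d := t.+1); lia.
exists p.
  apply/weakly_decreasingP => i j i' j' hx hy hxy.
  have := hx; have := hy; rewrite !mem_shifted => hy0 hx0.
  have ej : j = (i + (j - i))%N by lia.
  have ej' : j' = (i' + (j' - i'))%N by lia.
  rewrite ej in hx *; rewrite ej' in hy *.
  have [h1 h2] := htD _ _ hx; have [h3 h4] := htD _ _ hy.
  rewrite !hpv //.
  case/orP: hxy => /andP[/eqP ei /eqP ejj].
    have et : (j - i = (j' - i').+1)%N by lia.
    rewrite et in h1 h2 *; have [_] := hrow (j' - i')%N h4 i h1.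
    rewrite -/(L (j' - i')%N i.+1) -/(L (j' - i').+1 i) ei in h3 *.
    have := parts_ge_size lam (j' - i.+1).+1; case: ifP => h5; last by lia.
    by have := hb (j' - i.+1)%N ltac:(lia) i.+1 h3; lia.
  have et : (j' - i' = (j - i).+1)%N by lia.
  rewrite et ei in h3 h4 *; have [+ _] := hrow (j - i)%N h2 i h3.
  by rewrite -/(L (j - i)%N i) -/(L (j - i).+1 i); lia.
apply: (@eq_from_nth _ [::]); first by rewrite size_mkseq /= hs.
move=> t; rewrite size_mkseq => ht; rewrite nth_mkseq //.
apply: (@eq_from_nth _ 0%N); first by rewrite size_mkseq hsz.
move=> j; rewrite size_mkseq => hj.
have ei : j = (parts_ge lam t.+1 - (parts_ge lam t.+1 - j))%N by lia.
rewrite ei nth_diag_word; last by lia.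
rewrite hpv; last by lia.
by rewrite -/(L t (parts_ge lam t.+1 - j)%N); have := hb t ht (parts_ge lam t.+1 - j)%N ltac:(lia); lia.
Qed.

Lemma card_SPP : #|SPP m lam| = size (all_chains m lam).
Proof.
rewrite cardE -(size_map diag_words); apply/perm_size/uniq_perm.
- by rewrite map_inj_uniq ?enum_uniq //; exact: diag_words_inj.
- exact: uniq_all_chains.
move=> c; apply/mapP/idP => [[p]|/all_chains_diag[p hp <-]].
  by rewrite mem_enum inE => hp ->; apply: diag_words_mem.
by exists p => //; rewrite mem_enum inE.
Qed.

End CountSPP.

(** * Symmetric plane partitions *)

Lemma symmetric_arrayP m (D : {fset cell}) (p : {ffun D -> 'I_m.+1}) :
  reflect (forall i j, (i, j) \in D -> (j, i) \in D -> pval p i j = pval p j i)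
  (symmetric_array p).
Proof.
apply: (iffP forallP) => [h i j hx hy|h x].
  have /forallP/(_ (Sub (j, i) hy)) := h (Sub (i, j) hx).
  rewrite /= eqxx implyTb => /eqP e.
  by rewrite -[LHS]/(pval p (val (Sub (i, j) hx : D)).1 (val (Sub (i, j) hx : D)).2) pvalE e -pvalE.
apply/forallP => y; apply/implyP => /eqP e; apply/eqP/ord_inj; rewrite -!pvalE e /=.
case: x y e => -[i j] hx [[i' j'] hy] /= [ei ej]; subst; exact: h.
Qed.

Section Symmetrize.
Variables (m : nat) (lam : seq nat).
Hypothesis hlam : is_strict_partition lam.
Local Notation D := (shifted_diagram lam).
Local Notation D' := (young_diagram (overline lam)).

(** A cell on or above the main diagonal lies in the first [size lam] rows, where [overline lam] has
    the same row ends as the shifted diagram; symmetry gives the other cells. *)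
Lemma mem_overline_min i j : ((i, j) \in D') = ((minn i j, maxn i j) \in D).
Proof.
have H a b : (a <= b)%N -> ((a, b) \in D') = ((a, b) \in D).
  move=> hab; rewrite mem_overline // mem_shifted.
  have := @part_pos lam hlam a; case: ifP => h; lia.
case: (leqP i j) => hij; first by rewrite H.
by rewrite (overline_sym hlam) H ?(ltnW hij).
Qed.

Definition symmetrize (p : {ffun D -> 'I_m.+1}) : {ffun D' -> 'I_m.+1} :=
  [ffun x : D' => inord (pval p (minn (val x).1 (val x).2) (maxn (val x).1 (val x).2))].

Definition upper_half (q : {ffun D' -> 'I_m.+1}) : {ffun D -> 'I_m.+1} :=
  [ffun x : D => inord (pval q (val x).1 (val x).2)].

Lemma pval_symmetrize p i j : (i, j) \in D' ->
  pval (symmetrize p) i j = pval p (minn i j) (maxn i j).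
Proof.
move=> hx; have /= -> := pvalE (symmetrize p) (Sub (i, j) hx).
by rewrite ffunE /= inordK // ltnS pval_le.
Qed.

Lemma pval_upper_half q i j : (i, j) \in D -> pval (upper_half q) i j = pval q i j.
Proof.
move=> hx; have /= -> := pvalE (upper_half q) (Sub (i, j) hx).
by rewrite ffunE /= inordK // ltnS pval_le.
Qed.

Lemma shifted_le i j : (i, j) \in D -> (i <= j)%N.
Proof. by rewrite mem_shifted => /and4P[]. Qed.

Lemma shifted_overline i j : (i, j) \in D -> (i, j) \in D'.
Proof.
move=> hx; have h := shifted_le hx.
by rewrite mem_overline_min (minn_idPl h) (maxn_idPr h).
Qed.

Lemma symmetrizeK : cancel symmetrize upper_half.
Proof.
move=> p; apply/ffunP => -[[i j] hx]; apply: ord_inj; rewrite -!pvalE /=.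
rewrite pval_upper_half // pval_symmetrize ?shifted_overline //.
by rewrite (minn_idPl (shifted_le hx)) (maxn_idPr (shifted_le hx)).
Qed.

Lemma upper_halfK : {in PPsym m (overline lam), cancel upper_half symmetrize}.
Proof.
move=> q; rewrite inE => /andP[_ /symmetric_arrayP hs].
apply/ffunP => -[[i j] hx]; apply: ord_inj; rewrite -!pvalE /=.
rewrite pval_symmetrize // pval_upper_half -?mem_overline_min //.
by case: (leqP i j) => h //; rewrite hs // (overline_sym hlam).
Qed.

Lemma symmetrize_PPsym p : p \in SPP m lam -> symmetrize p \in PPsym m (overline lam).
Proof.
rewrite !inE => /weakly_decreasingP h; apply/andP; split.
  apply/weakly_decreasingP => i j i' j' hx hy hxy; rewrite !pval_symmetrize //.
  rewrite !mem_overline_min in hx hy; apply: h => //; lia.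
by apply/symmetric_arrayP => i j hx hy; rewrite !pval_symmetrize // minnC maxnC.
Qed.

Lemma upper_half_SPP q : q \in PPsym m (overline lam) -> upper_half q \in SPP m lam.
Proof.
rewrite !inE => /andP[/weakly_decreasingP h _].
apply/weakly_decreasingP => i j i' j' hx hy hxy; rewrite !pval_upper_half //.
by apply: h => //; apply: shifted_overline.
Qed.

Lemma card_PPsym : #|PPsym m (overline lam)| = #|SPP m lam|.
Proof.
apply/eqP; rewrite eqn_leq; apply/andP; split.
  rewrite -(card_in_imset (can_in_inj upper_halfK)); apply/subset_leq_card/subsetP => x.
  by case/imsetP => q hq ->; apply: upper_half_SPP.
rewrite -(card_imset _ (can_inj symmetrizeK)); apply/subset_leq_card/subsetP => x.
by case/imsetP => p hp ->; apply: symmetrize_PPsym.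
Qed.

End Symmetrize.

Theorem theorem4p3 (m : nat) (lam : seq nat)
    (hm : (0 < m)%N) (hlam : is_strict_partition lam) :
  (#|SPP m lam|%:R ^+ 2 = #|PPsym m (overline lam)|%:R ^+ 2 :> rat) /\
  (#|PPsym m (overline lam)|%:R ^+ 2 = 2 ^+ size lam * M_A m lam :> rat).
Proof.
rewrite card_PPsym //; split=> //.
by rewrite tilings_square // colsum_chains // card_SPP.
Qed.
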